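(* Let $V$ be a finite-dimensional vector space over $\mathbb{R}$ or over $\mathbb{Q}_p$, let $m\ge 1$, and let $T_1,\dots,T_m$ be contractions on $V$ such that $T_iT_j=T_jT_i$ for all $1\le i,j\le m$. Suppose $\mu\in\mathcal{P}(V)$ satisfies $\mu=T_1(\mu)*T_2(\mu)*\cdots*T_m(\mu)$. Then $\mu$ is infinitely divisible without idempotent factors. In particular, every autophage measure on $V$ is infinitely divisible without idempotent factors.
   Context: $p$ is a prime. $V$ is regarded as a locally compact second countable abelian group under addition, with identity $e=0$. $\mathcal{P}(V)$ is the space of Borel probability measures on $V$ and $*$ is convolution. For a continuous automorphism $T$ of $V$ (with continuous inverse) and $\mu\in\mathcal{P}(V)$, $T(\mu)(B)=\mu(T^{-1}(B))$ for Borel sets $B$. A contraction of $V$ is a continuous automorphism $T$ of $V$ such that $T^n x\to e$ as $n\to\infty$ for every $x\in V$. A measure $\mu\in\mathcal{P}(V)$ is autophage if there exist contractions $T$ and $S$ of $V$ with $TS=ST$ and $\mu=T(\mu)*S(\mu)$. A measure $\mu$ is infinitely divisible if for every $n\ge1$ there is $\mu_n\in\mathcal{P}(V)$ whose $n$-th convolution power is $\mu$. $\mu$ has no idempotent factors if there is no nontrivial compact subgroup $K$ of $V$ and $\nu\in\mathcal{P}(V)$ with $\mu=\omega_K*\nu$, where $\omega_K$ is the normalized Haar measure of $K$. *)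

(* Defs.v *)
From HB Require Import structures.
From mathcomp Require Import all_boot all_order all_algebra.
From mathcomp Require Import all_classical all_reals all_analysis.

Set Implicit Arguments.
Unset Strict Implicit.
Unset Printing Implicit Defensive.

Import Order.TTheory GRing.Theory Num.Theory.
Import numFieldNormedType.Exports.

Local Open Scope classical_set_scope.
Local Open Scope ring_scope.

(* Second countable Hausdorff topological abelian groups. *)
Record sctGroup := SctGroup {
  sct_sort :> topologicalZmodType;
  sct_second_countable : @second_countable sct_sort;
  sct_hausdorff : hausdorff_space sct_sort }.

(* [g_sigma_algebraType] needs a pointed carrier. *)
Definition pointed_at_0 (V : zmodType) : Type := V.
HB.instance Definition _ (V : zmodType) := Choice.on (pointed_at_0 V).
HB.instance Definition _ (V : zmodType) :=
  isPointed.Build (pointed_at_0 V) (0 : V).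

Definition borel (V : topologicalZmodType) :=
  g_sigma_algebraType (@open V : set (set (pointed_at_0 V))).

Lemma countable_bigcup_measurable d (T : measurableType d) I (P : set I)
    (F : I -> set T) :
  countable P -> (forall i, P i -> measurable (F i)) ->
  measurable (\bigcup_(i in P) F i).
Proof.
have [-> _ _|/set0P[i0 Pi0]] := eqVneq P set0; first by rewrite bigcup_set0.
move=> /countable_injP[f injf] mF.
rewrite (_ : \bigcup_(i in P) F i =
    \bigcup_(k in f @` P) F ('pinv_(cst i0) P f k)); last first.
  rewrite eqEsubset; split => [t [i Pi Ft]|t [_ [i Pi <-]]].
    by exists (f i); [exists i|rewrite pinvKV// inE].
  by rewrite pinvKV ?inE// => Ft; exists i.
by apply: bigcup_measurable => _ [i Pi <-]; rewrite pinvKV ?inE//; exact: mF.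
Qed.

Lemma continuous_borel_measurable (V : topologicalZmodType) (f : V -> V) :
  continuous f -> measurable_fun [set: borel V] (f : borel V -> borel V).
Proof.
move=> /continuousP cf.
apply: (@measurability _ _ _ (borel V) _ _ (@open V)) => //.
move=> _ [B oB <-]; rewrite setTI.
by apply: sub_sigma_algebra; exact: cf.
Qed.

Definition borel_add (V : sctGroup) (z : borel V * borel V) : borel V :=
  (z.1 : V) + (z.2 : V).

Lemma borel_add_measurable (V : sctGroup) :
  measurable_fun [set: borel V * borel V] (@borel_add V).
Proof.
apply: (@measurability _ _ _ (borel V) _ _ (@open V)) => //.
move=> _ [U oU <-]; rewrite setTI.
have [B cB [Bo Bb]] := @sct_second_countable V.
pose P := [set AA : set V * set V | (B `*` B) AA /\
  AA.1 `*` AA.2 `<=` (fun z : V * V => z.1 + z.2) @^-1` U].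
have cP : countable P.
  apply: (@sub_countable _ _ _ (B `*` B)); last exact: countableX.
  by apply: subset_card_le => AA [].
rewrite (_ : _ @^-1` U = \bigcup_(AA in P) (AA.1 `*` AA.2)); last first.
  rewrite eqEsubset; split => [[x y]/= Uxy|z [AA [_ +] zAA]]; last exact.
  have := @add_continuous V (x, y) U.
  have : nbhs (x + y) U by exact: open_nbhs_nbhs.
  move=> /[swap] /[apply] -[[N1 N2]/= [/Bb[A1 [BA1 A1x] A1N] /Bb[A2 [BA2 A2y] A2N]] NU].
  exists (A1, A2) => //=; split=> //= z [/A1N z1 /A2N z2].
  exact: NU.
apply: countable_bigcup_measurable => // -[A1 A2] [[/= BA1 BA2] _].
by apply: measurableX; apply: sub_sigma_algebra; exact: Bo.
Qed.

HB.instance Definition _ (V : sctGroup) :=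
  isMeasurableFun.Build _ _ _ (borel V) (@borel_add V)
    (@borel_add_measurable V).

Section Convolution.
Variables (R : realType) (V : sctGroup).
Implicit Types mu nu : probability (borel V) R.

(* A measure is a function on all subsets, and only its values on measurable
   sets are meaningful; Leibniz equality would be too strong. *)
Definition eq_prob mu nu := forall B, measurable B -> mu B = nu B.

Definition convolution mu nu : probability (borel V) R :=
  distribution (mu \x nu)%E (@borel_add V).

Definition dirac_at_0 : probability (borel V) R :=
  @dirac _ (borel V) (0 : V) R.

Definition convolution_power mu n := \big[convolution/dirac_at_0]_(i < n) mu.

Definition infinitely_divisible mu :=
  forall n, (0 < n)%N -> exists nu, eq_prob mu (convolution_power nu n).

Definition subgroup (K : set V) :=
  K 0 /\ (forall x y, K x -> K y -> K (x - y)).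

(* The normalized Haar measure of a compact subgroup K, seen as a measure on
   the whole group: translation invariance under K and total mass on K. *)
Definition normalized_haar (K : set V) (omega : probability (borel V) R) :=
  omega K = 1%E /\
  forall x (B : set V), K x -> @measurable _ (borel V) B ->
    omega ((fun y => x + y) @^-1` B) = omega B.

Definition has_idempotent_factor mu :=
  exists (K : set V) (omega nu : probability (borel V) R),
    [/\ subgroup K, compact K, K <> [set 0], normalized_haar K omega &
        eq_prob mu (convolution omega nu)].

End Convolution.

Record contractive_automorphism (V : topologicalZmodType) := Contraction {
  contraction_fun :> V -> V;
  contraction_add : {morph contraction_fun : x y / x + y};
  contraction_continuous : continuous contraction_fun;
  contraction_inverse : exists S : V -> V,
    [/\ cancel contraction_fun S, cancel S contraction_fun & continuous S];
  contraction_cvg :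
    forall x : V, iter n contraction_fun x @[n --> \oo] --> (0 : V) }.

Definition borel_contraction (V : topologicalZmodType)
    (T : contractive_automorphism V) :
  borel V -> borel V := T.

HB.instance Definition _ (V : topologicalZmodType) (T : contractive_automorphism V) :=
  isMeasurableFun.Build _ _ _ (borel V) (borel_contraction T)
    (continuous_borel_measurable (@contraction_continuous V T)).

Definition image_prob (R : realType) (V : topologicalZmodType)
    (T : contractive_automorphism V) (mu : probability (borel V) R) :
  probability (borel V) R := distribution mu (borel_contraction T).

Definition autophage (R : realType) (V : sctGroup)
    (mu : probability (borel V) R) :=
  exists T S : contractive_automorphism V, (forall x, T (S x) = S (T x)) /\
    eq_prob mu (convolution (image_prob T mu) (image_prob S mu)).

(* A field complete for an absolute value, in which rat is dense: it is the
   completion of rat for the absolute value rc_abs \o ratr. *)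
Record ratCompletion (R : realType) := RatCompletion {
  rc_field :> fieldType;
  rc_abs : rc_field -> R;
  rc_abs_ge0 : forall x, 0 <= rc_abs x;
  rc_abs_eq0 : forall x, (rc_abs x == 0) = (x == 0);
  rc_absM : {morph rc_abs : x y / x * y};
  rc_absD : forall x y, rc_abs (x + y) <= rc_abs x + rc_abs y;
  rc_dense : forall x e, 0 < e -> exists q : rat, rc_abs (x - ratr q) < e;
  rc_complete : forall u : nat -> rc_field,
    (forall e, 0 < e -> exists N, forall m n, (N <= m)%N -> (N <= n)%N ->
      rc_abs (u m - u n) < e) ->
    exists l, forall e, 0 < e -> exists N, forall n, (N <= n)%N ->
      rc_abs (u n - l) < e }.

Section RealCompletion.
Variable R : realType.

Let real_dense (x e : R) : 0 < e -> exists q : rat, `|x - ratr q| < e.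
Proof.
move=> e0; have [|q] := @rat_in_itvoo _ (x - e) x; first by rewrite ltrBlDr ltrDl.
rewrite in_itv/= => /andP[xq qx]; exists q.
by rewrite gtr0_norm ?subr_gt0// ltrBlDr -ltrBlDl.
Qed.

Let real_complete (u : nat -> R) :
  (forall e, 0 < e -> exists N, forall m n, (N <= m)%N -> (N <= n)%N ->
    `|u m - u n| < e) ->
  exists l, forall e, 0 < e -> exists N, forall n, (N <= n)%N -> `|u n - l| < e.
Proof.
move=> cu; have /R_complete/cvg_ex[l /cvgrPdistC_lt ul] : cauchy (u @ \oo).
  apply/cauchy_ballP => e e0; have [N uN] := cu _ e0.
  exists (u @` [set n | (N <= n)%N], u @` [set n | (N <= n)%N]).
    by split; exists N => // n Nn; exists n.
  by move=> [_ _]/= [[m Nm <-] [n Nn <-]]; exact: uN.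
exists l => e /ul[N _ uN]; exists N => n Nn; exact: uN.
Qed.

Definition real_completion : ratCompletion R :=
  @RatCompletion R R Num.norm (@normr_ge0 _ _) (@normr_eq0 _ _) (@normrM _)
    (@ler_normD _ _) real_dense real_complete.

End RealCompletion.

(* p ^ (- v_p(q)) *)
Definition padic_abs (R : realType) (p : nat) (q : rat) : R :=
  if q == 0 then 0
  else (p%:R : R) ^ ((logn p `|denq q|)%:Z - (logn p `|numq q|)%:Z).

(* K is the field of p-adic numbers, up to isometric isomorphism. *)
Definition is_padic (R : realType) (p : nat) (K : ratCompletion R) :=
  forall q : rat, rc_abs (ratr q : K) = padic_abs R p q.

Section RatCompletionTheory.
Variables (R : realType) (K : ratCompletion R).
Local Notation "`[ x ]" := (@rc_abs R K x).

Lemma rc_abs0 : `[0] = 0.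
Proof. by apply/eqP; rewrite rc_abs_eq0. Qed.

Lemma rc_abs1 : `[1] = 1.
Proof.
have /eqP := rc_absM (1 : K) 1; rewrite mulr1 -subr_eq0 -[X in X - _]mulr1.
rewrite -mulrBr mulf_eq0 rc_abs_eq0 oner_eq0 subr_eq0 /= => /eqP.
by [].
Qed.

Lemma rc_absN x : `[- x] = `[x].
Proof.
suff N1 : `[-1] = 1 by rewrite -mulN1r rc_absM N1 mul1r.
have /eqP : `[-1] ^+ 2 = 1 by rewrite expr2 -rc_absM mulrNN mulr1 rc_abs1.
rewrite sqrf_eq1 => /orP[/eqP//|/eqP N1].
by have := rc_abs_ge0 (-1 : K); rewrite N1 ler0N1.
Qed.

End RatCompletionTheory.

(* A finite-dimensional vector space with its canonical topology: the one
   carried over from the product topology by the coordinates in a basis. *)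
Definition fin_dim_group (R : realType) (K : ratCompletion R)
  (E : vectType K) : Type := E.

Section FinDimGroup.
Variables (R : realType) (K : ratCompletion R) (E : vectType K).
Local Notation V := (fin_dim_group E).

HB.instance Definition _ := GRing.Zmodule.on V.

Definition coord_dist (x y : V) : R := \big[Num.max/0]_(i < \dim {:E})
  rc_abs (coord (vbasis {:E}) i x - coord (vbasis {:E}) i y).

Lemma coord_dist_lt x y e : 0 < e ->
  (forall i, rc_abs (coord (vbasis {:E}) i x - coord (vbasis {:E}) i y) < e) ->
  coord_dist x y < e.
Proof. by move=> e0 xy; apply: bigmax_lt. Qed.

Lemma le_coord_dist x y i :
  rc_abs (coord (vbasis {:E}) i x - coord (vbasis {:E}) i y) <= coord_dist x y.
Proof. exact: (le_bigmax _ (fun i => rc_abs _)). Qed.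

Let distxx x : coord_dist x x = 0.
Proof. by apply: bigmax_eq_id => i _; rewrite subrr rc_abs0. Qed.

Let dist_positivity x y : coord_dist x y = 0 -> x = y.
Proof.
move=> xy0; have xy i : coord (vbasis {:E}) i x = coord (vbasis {:E}) i y.
  apply/eqP; rewrite -subr_eq0 -rc_abs_eq0 eq_le rc_abs_ge0 andbT -[leRHS]xy0.
  exact: le_coord_dist.
rewrite (coord_vbasis (memvf (x : E))) (coord_vbasis (memvf (y : E))).
by apply: eq_bigr => i _; rewrite xy.
Qed.

Let dist_sym x y : coord_dist x y = coord_dist y x.
Proof. by apply: eq_bigr => i _; rewrite -rc_absN opprB. Qed.

Let dist_triangle y x z : coord_dist x z <= coord_dist x y + coord_dist y z.
Proof.
apply: bigmax_le => [|i _].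
  by rewrite addr_ge0// bigmax_ge_id.
rewrite -(subrKA (coord (vbasis {:E}) i y)) (le_trans (rc_absD _ _))//.
by rewrite lerD// le_coord_dist.
Qed.

HB.instance Definition _ :=
  isMetric.Build R V distxx dist_positivity dist_sym dist_triangle.

Let dist_add x y x' y' :
  coord_dist (x + y) (x' + y') <= coord_dist x x' + coord_dist y y'.
Proof.
apply: bigmax_le => [|i _].
  by rewrite addr_ge0// bigmax_ge_id.
rewrite !linearD/= opprD addrACA (le_trans (rc_absD _ _))//.
by rewrite lerD// le_coord_dist.
Qed.

Let dist_opp x y : coord_dist (- x) (- y) = coord_dist x y.
Proof.
by apply: eq_bigr => i _; rewrite !linearN/= -rc_absN opprB opprK addrC.
Qed.

Let sub_cont : continuous (fun z : V * V => z.1 - z.2).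
Proof.
move=> [x y]; apply/metricType_numDomainType.cvgrPdist_lt => e e0.
near=> z.
rewrite /= (le_lt_trans (dist_add _ _ _ _))// dist_opp (splitr e) ltrD//.
- near: z. exists (ball x (e/2), setT); first by split; [apply: nbhsx_ballx; rewrite divr_gt0|exact: filterT].
  by move=> [a b] [] .
- near: z. exists (setT, ball y (e/2)); first by split; [exact: filterT|apply: nbhsx_ballx; rewrite divr_gt0].
  by move=> [a b] [] .
Unshelve. all: by end_near. Qed.

HB.instance Definition _ :=
  PreTopologicalNmodule_isTopologicalZmodule.Build V sub_cont.

Lemma fin_dim_second_countable : @second_countable V.
Proof.
pose b := vbasis {:E}.
pose pt (q : {ffun 'I_(\dim {:E}) -> rat}) : V :=
  \sum_i (ratr (q i) : K) *: b`_i.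
pose U (qk : {ffun 'I_(\dim {:E}) -> rat} * nat) : set V :=
  (ball (pt qk.1) (qk.2.+1%:R^-1 : R))^°.
have free_b : free b by exact: basis_free (vbasisP _).
exists (range U); first exact: sub_countable (card_image_le _ _) (countableP _).
split; first by move=> _ [qk _ <-]; exact: open_interior.
move=> x N /nbhs_ballP[e /= e0 xeN].
have [k /= ke] : exists k, k.+1%:R^-1 < e / 2.
  exists (Num.truncn (e / 2)^-1).
  by rewrite invf_plt ?posrE ?divr_gt0// truncnS_gt.
have k0 : 0 < (k.+1%:R^-1 : R) by [].
have /choice[q xq] : forall i, exists q : rat,
  rc_abs (coord b i x - (ratr q : K)) < k.+1%:R^-1 by move=> i; exact: rc_dense.
have xpt : coord_dist x (pt [ffun i => q i]) < k.+1%:R^-1.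
  apply: coord_dist_lt => // i.
  rewrite (_ : coord _ i (pt _) = ratr (q i)); first exact: xq.
  by rewrite (coord_sum_free (fun i => ratr ([ffun i => q i] i))) ?ffunE.
exists (U ([ffun i => q i], k)); first split => /=; first by exists ([ffun i => q i], k).
  apply/nbhs_ballP; exists (k.+1%:R^-1 - coord_dist x (pt [ffun i => q i])).
    by rewrite /= subr_gt0.
  move=> y xy; rewrite /ball/=.
  rewrite (le_lt_trans (dist_triangle x _ _))//.
  by rewrite (dist_sym _ x) addrC -ltrBrDr.
move=> y /interior_subset ky; apply: xeN.
rewrite /ball/= (le_lt_trans (dist_triangle (pt [ffun i => q i]) _ _))//.
by rewrite (splitr e) ltrD// (lt_trans _ ke).
Qed.

Definition fin_dim_sctGroup : sctGroup :=
  @SctGroup V fin_dim_second_countable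
    (@metric_hausdorff R V).

End FinDimGroup.

(* Main.v *)
From HB Require Import structures.
Require Import Defs.
From mathcomp Require Import all_boot all_order all_algebra.
From mathcomp Require Import all_classical all_reals all_analysis.
From mathcomp Require Import measurable_realfun.
From mathcomp Require Import lra ring zify.

(** Why the theorem holds. Write [N] for the sup norm of the coordinates, and
    [T_w] for the composite of the [T_i] along a word [w]; it depends only on
    the letters of [w] counted with multiplicity, and it shrinks [N] by a factor
    of order [r ^ size w] with [r < 1]: additive continuous maps are linear over
    a completion of the rationals, so convergence to 0 on a basis yields a
    geometric rate ([act_bound]).  Substituting the equation for [mu] into itself
    writes [mu] as the convolution of the laws [T_w(mu)] over all words [w] of
    length [n].

    Roots.  Fix [k > 0].  Among the words of length [n + 1] that come from the
    words left over at length [n], equal letter counts give equal laws, so the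
    words can be collected in groups of [k] copies, except for fewer than [k] of
    each kind, which are left over for the next length.  Hence
    [mu = (s_0 * ... * s_(n-1)) ^ k * rho_n], where [s_n] and [rho_n] are
    convolutions of only polynomially many laws [T_w(mu)], each contracted by
    [r ^ n] ([mu_leftovers]).  If [s_n] and [rho_n] are exponentially close to
    the unit mass at [0], the infinite convolution of the [s_n] exists and its
    [k]-th power is [mu].  It is the law of a random series on a
    countable product space ([iprod], obtained from finite products by
    Kakutani's argument and measure extension), see [infinite_convolution]; the
    identity passes to the limit by [limit_unique].

    Closeness to the unit mass asks that [mu] have a polynomially small tail
    [t(x) = mu (N > x)].  If [m >= 2], then two independent summands [T_1 X_1]
    and [T_2 X_2] can each be the only large one, and these events are disjoint;
    since [T_i] distorts [N] by a bounded factor, this gives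
    [t(C x) <= 2/3 t(x)] for large [x], hence the bound ([tail_doubling],
    [tail_decay]).  If [m = 1], then [mu = T_1^n(mu)] for all [n], so [mu] is the
    unit mass at [0].

    Idempotent factors.  If [mu = omega_K * nu] with [K] nontrivial, then [mu] is
    invariant under translation by some [h <> 0].  Over the reals the multiples
    of [h] are unbounded, which contradicts tightness.  Over the [p]-adic
    numbers the ball [U] of radius [N h] is a subgroup that does not contain
    [h], and a law giving [U] mass at least 2/3 acts injectively by convolution
    on bounded [U]-invariant functions ([agree_conv]).  All [T_w(mu)] with [w]
    long give such laws, so they can be removed one after the other from
    [mu], and the unit mass at [0] would not distinguish [U] from a disjoint
    translate of [U] ([agree_big]). *)

Set Implicit Arguments.
Unset Strict Implicit.
Unset Printing Implicit Defensive.

Import Order.TTheory GRing.Theory Num.Theory.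
Import numFieldNormedType.Exports.

Local Open Scope classical_set_scope.
Local Open Scope ring_scope.

(** * Countable products of probability measures *)

Section InfiniteProduct.
Context d (V : measurableType d) (R : realType).

Definition sequence_space : Type := nat -> V.
HB.instance Definition _ := Pointed.on sequence_space.

Definition coordinate_sets : set (set sequence_space) :=
  [set A | exists n (B : set V), measurable B /\ A = (fun w => w n) @^-1` B].

Definition seqT := g_sigma_algebraType coordinate_sets.

Definition scons (z : V * seqT) : seqT :=
  fun n => if n is n'.+1 then (z.2 : sequence_space) n' else z.1.

Lemma measurable_coord n : measurable_fun [set: seqT] (fun w : seqT => w n : V).
Proof.
move=> _ B mB; rewrite setTI; apply: sub_sigma_algebra.
by exists n, B.
Qed.

Lemma measurable_scons : measurable_fun [set: V * seqT] scons.
Proof.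
apply: (@measurability _ _ _ seqT _ _ coordinate_sets) => //.
move=> _ [_ [n [B [mB ->]]] <-]; rewrite setTI -comp_preimage.
case: n => [|n].
  rewrite (_ : _ @^-1` _ = fst @^-1` B)//.
  by rewrite -[X in measurable X]setTI; exact: measurable_fst.
rewrite (_ : _ @^-1` _ = (fun z : V * seqT => z.2 n) @^-1` B)//.
rewrite -[X in measurable X]setTI.
exact: (measurableT_comp (measurable_coord n) measurable_snd).
Qed.

HB.instance Definition _ := isMeasurableFun.Build _ _ _ _ scons measurable_scons.

(** The section of a set of sequences at a first term; all recursions below
    peel off one coordinate in this way. *)
Definition cons_section (x : V) (A : set seqT) : set seqT :=
  [set w | A (scons (x, w))].

Lemma measurable_cons_section x A : measurable A -> measurable (cons_section x A).
Proof.
move=> mA; rewrite -[X in measurable X]setTI.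
have /(_ measurableT A mA)// := measurableT_comp measurable_scons (measurable_pair1 x).
Qed.

Definition depends_on_first n (A : set seqT) :=
  forall w w' : seqT, (forall i, (i < n)%N -> w i = w' i) -> A w -> A w'.

Lemma depends_cons_section n A x : depends_on_first n.+1 A -> depends_on_first n (cons_section x A).
Proof. by move=> An w w' ww'; apply: An => -[|i]//=; exact: ww'. Qed.

Lemma depends_leq m n A : (m <= n)%N -> depends_on_first m A -> depends_on_first n A.
Proof.
by move=> mn Am w w' ww'; apply: Am => i im; apply: ww'; exact: leq_trans mn.
Qed.

(** The product of the first [n] measures, carried by the sequences that are
    constant from rank [n] on. Living on one fixed space, these measures need
    no dependent types of tuples. *)
Fixpoint finite_prod n (s : nat -> probability V R) : probability seqT R :=
  if n is n'.+1 then distribution (s 0%N \x finite_prod n' (fun k => s k.+1))%E scons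
  else @dirac _ seqT point R.

Lemma finite_prodS n s A : measurable A ->
  finite_prod n.+1 s A = (\int[s 0%N]_x finite_prod n (fun k => s k.+1) (cons_section x A))%E.
Proof.
move=> mA; rewrite /= /distribution/pushforward/=/product_measure1.
apply: eq_integral => x _/=; congr (finite_prod _ _ _).
by apply/seteqP; split => w; rewrite /xsection/= in_setE.
Qed.

Lemma measurable_finite_prod_section n (s : nat -> probability V R) A : measurable A ->
  measurable_fun [set: V] ((fun x => finite_prod n s (cons_section x A)) : V -> \bar R).
Proof.
move=> mA.
have mB : measurable (scons @^-1` A).
  by rewrite -[X in measurable X]setTI; exact: measurable_scons.
rewrite (_ : (fun x => _) = finite_prod n s \o xsection (scons @^-1` A)).
  exact: measurable_fun_xsection.
apply/funext => x /=.
by congr (finite_prod _ _ _); apply/seteqP; split => w; rewrite /xsection/= in_setE.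
Qed.

(** Consistency of the finite products: coordinates beyond those that a set
    depends on integrate out. *)
Lemma finite_prod_depends n m s A : measurable A -> depends_on_first n A -> (n <= m)%N ->
  finite_prod m s A = finite_prod n s A.
Proof.
elim: n m s A => [|n IH] m s A mA An nm.
  have [->|/set0P[w Aw]] := eqVneq A set0; first by rewrite !measure0.
  suff -> : A = setT by rewrite !probability_setT.
  by apply/seteqP; split => // w' _; exact: An Aw.
case: m nm => // m nm; rewrite !finite_prodS//.
apply: eq_integral => x _; apply: IH => //; first exact: measurable_cons_section.
exact: depends_cons_section.
Qed.

Definition cylinder (A : set seqT) := measurable A /\ exists n, depends_on_first n A.

(** A copy of the sequence space that carries the algebra of cylinders, which
    is not a sigma-algebra. *)
Definition cylT : Type := seqT.
HB.instance Definition _ := Pointed.on cylT.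

Lemma cylinder0 : cylinder set0.
Proof. by split; [exact: measurable0|exists 0%N]. Qed.

Lemma cylinderU : setU_closed cylinder.
Proof.
move=> A B [mA [n nA]] [mB [m mB']]; split; first exact: measurableU.
exists (maxn n m) => w w' ww' [Aw|Bw]; [left|right].
  by apply: nA Aw => i ?; apply: ww'; rewrite leq_max; apply/orP; left.
by apply: mB' Bw => i ?; apply: ww'; rewrite leq_max; apply/orP; right.
Qed.

Lemma cylinderC : setC_closed cylinder.
Proof.
move=> A [mA [n nA]]; split; first exact: measurableC.
exists n => w w' ww' Aw Aw'; apply: Aw; apply: nA Aw' => i ?.
by rewrite ww'.
Qed.

Definition cyl_display : measure_display.
Proof. exact: default_measure_display. Qed.
HB.instance Definition _ := @isAlgebraOfSets.Build cyl_display cylT cylinder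
  cylinder0 cylinderU cylinderC.

Definition stail (s : nat -> probability V R) := fun k => s k.+1.

(** The value that the finite products agree on from some rank on; the default
    0 is never met on a cylinder. *)
Definition cyl_content (s : nat -> probability V R) (A : set cylT) : \bar R :=
  if pselect (exists n, depends_on_first n A) is left h then finite_prod (sval (cid h)) s A
  else 0%E.

Lemma cyl_contentE n s A : measurable (A : set seqT) -> depends_on_first n A ->
  cyl_content s A = finite_prod n s A.
Proof.
move=> mA nA; rewrite /cyl_content; case: pselect => [h|]; last by case; exists n.
move: (sval (cid h)) (svalP (cid h)) => m /= mA'.
have [mn|/ltnW nm] := leqP m n; last exact: finite_prod_depends.
by apply/esym; exact: finite_prod_depends.
Qed.

Lemma cyl_content_ge0 s A : (0 <= cyl_content s A)%E.
Proof. by rewrite /cyl_content; case: pselect. Qed.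

Lemma cyl_content0 s : cyl_content s set0 = 0%E.
Proof. by rewrite (@cyl_contentE 0)// measure0. Qed.

Lemma cyl_content_le1 s A : cylinder A -> (cyl_content s A <= 1)%E.
Proof. by move=> [mA [n nA]]; rewrite (cyl_contentE _ mA nA) probability_le1. Qed.

Lemma cyl_content_fin s A : cylinder A -> cyl_content s A \is a fin_num.
Proof.
move=> cA; rewrite ge0_fin_numE ?cyl_content_ge0//.
by rewrite (le_lt_trans (cyl_content_le1 s cA))// ltry.
Qed.

Lemma cyl_contentU s A B : cylinder A -> cylinder B -> A `&` B = set0 ->
  cyl_content s (A `|` B) = (cyl_content s A + cyl_content s B)%E.
Proof.
move=> [mA [n nA]] [mB [m mB']] AB0.
have nA' : depends_on_first (maxn n m) A by apply: depends_leq nA; rewrite leq_maxl.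
have mB'' : depends_on_first (maxn n m) B by apply: depends_leq mB'; rewrite leq_maxr.
rewrite (cyl_contentE s mA nA') (cyl_contentE s mB mB'').
rewrite -measureU//; apply: cyl_contentE; first exact: measurableU.
by move=> w w' ww' [/(nA' _ _ ww')|/(mB'' _ _ ww')]; [left|right].
Qed.

Lemma cylinder_cons_section x A : cylinder A -> cylinder (cons_section x A).
Proof.
move=> [mA [n nA]]; split; first exact: measurable_cons_section.
by exists n; apply: depends_cons_section; apply: depends_leq nA.
Qed.

Lemma measurable_cyl_content_section s A : cylinder A ->
  measurable_fun [set: V] (fun x => cyl_content s (cons_section x A)).
Proof.
move=> [mA [n nA]].
rewrite (_ : (fun x => _) = fun x => finite_prod n s (cons_section x A)).
  exact: measurable_finite_prod_section.
apply/funext => x; apply: cyl_contentE; first exact: measurable_cons_section.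
by apply: depends_cons_section; apply: depends_leq nA.
Qed.

Lemma cyl_content_section s A : cylinder A ->
  cyl_content s A = (\int[s 0%N]_x cyl_content (stail s) (cons_section x A))%E.
Proof.
move=> [mA [n nA]].
have nA1 : depends_on_first n.+1 A by apply: depends_leq nA.
rewrite (cyl_contentE s mA nA1) finite_prodS//.
apply: eq_integral => x _; apply/esym/cyl_contentE; first exact: measurable_cons_section.
exact: depends_cons_section.
Qed.

(** A decreasing sequence of cylinders whose contents stay away from 0. *)
Definition nonvanishing (s : nat -> probability V R) (B : nat -> set seqT) :=
  [/\ forall j, cylinder (B j), forall j, B j.+1 `<=` B j &
    exists2 e : R, 0 < e & forall j, (e%:E <= cyl_content s (B j))%E].

(** The heart of Kakutani's argument. The points whose sections all have
    content at least [e / 2] form a set of measure at least [e / 2], since the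
    content is the integral of the contents of the sections; so one of them
    can be chosen as first coordinate. *)
Lemma nonvanishing_section s B : nonvanishing s B ->
  exists x, nonvanishing (stail s) (fun j => cons_section x (B j)).
Proof.
move=> [cB dB [e e0 eB]].
pose g j x := cyl_content (stail s) (cons_section x (B j)).
have mg j : measurable_fun setT (g j) by exact: measurable_cyl_content_section.
pose G j : set V := [set x | ((e / 2)%:E <= g j x)%E].
have mG j : measurable (G j).
  rewrite -[G j]setTI; apply: emeasurable_fun_c_infty => //.
have e20 : 0 < e / 2 by rewrite divr_gt0.
have dG : {homo G : n m / (n <= m)%N >-> (m <= n)%O}.
  apply/nonincreasing_seqP => j; apply/subsetPset => x; rewrite /G/= => h.
  apply: le_trans h _; rewrite /g.
  have [mj1 [n1 nj1]] := cylinder_cons_section x (cB j.+1).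
  have [mj [n nj]] := cylinder_cons_section x (cB j).
  rewrite (@cyl_contentE (maxn n n1))//; last by apply: depends_leq nj1; rewrite leq_maxr.
  rewrite (@cyl_contentE (maxn n n1))//; last by apply: depends_leq nj; rewrite leq_maxl.
  by apply: le_measure; rewrite ?inE// => w /dB.
(* outside G j the integrand is at most e / 2 *)
have sG j : ((e / 2)%:E <= s 0%N (G j))%E.
  have : (e%:E <= s 0%N (G j) + (e / 2)%:E)%E.
    apply: (le_trans (eB j)); rewrite cyl_content_section// -/(g j).
    apply: (@le_trans _ _ (\int[s 0%N]_x ((\1_(G j) x)%:E + (e / 2)%:E))%E).
      apply: ge0_le_integral => //.
      - by move=> x _; exact: cyl_content_ge0.
      - exact: mg.
      - apply: (@emeasurable_funD _ _ _ _ (fun x => (\1_(G j) x)%:E) (cst (e / 2)%:E)) => //.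
        apply/measurable_EFinP.
        exact: measurable_indic.
      - move=> x _; rewrite indicE; case: (boolP (x \in G j)) => xG.
          rewrite (@le_trans _ _ 1%E) ?cyl_content_le1//; first exact: cylinder_cons_section.
          by rewrite leeDl// lee_fin ltW.
        rewrite add0e ltW// ltNge; apply/negP => h; move/negP: xG; apply.
        by rewrite inE.
    rewrite ge0_integralD//=.
    - rewrite integral_indic// setIT integral_cst//= probability_setT mule1.
      exact: lexx.
    - by apply/measurable_EFinP; exact: measurable_indic.
    - by move=> x _; rewrite lee_fin ltW.
  rewrite {1}(splitr e) EFinD leeD2rE//.
have : (s 0%N \o G) @ \oo --> s 0%N (\bigcap_j G j).
  apply: nonincreasing_cvg_mu => //.
  - by rewrite (le_lt_trans (probability_le1 _ _))// ltry.
  - exact: bigcap_measurable.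
move=> cvG.
have : ((e / 2)%:E <= s 0%N (\bigcap_j G j))%E.
  apply: (closed_cvg (fun x => (e/2)%:E <= x)%E) cvG => //.
    exact: closed_ereal_le_ereal.
  exact: nearW.
have [->|/set0P[x Gx] _] := eqVneq (\bigcap_j G j) set0.
  by rewrite measure0 lee_fin leNgt e20.
exists x; split.
- by move=> j; exact: cylinder_cons_section.
- by move=> j w /dB.
- by exists (e / 2) => // j; exact: Gx.
Qed.

(** Choosing the coordinates one after the other gives a sequence all of whose
    sections are nonempty; as a cylinder depends on finitely many coordinates,
    the sequence belongs to it. *)
Lemma nonvanishing_bigcap s B : nonvanishing s B -> exists w, forall j, B j w.
Proof.
move=> sB.
pose Z := ((nat -> probability V R) * (nat -> set seqT))%type.
have /choice[X XP] : forall z : Z, exists x, nonvanishing z.1 z.2 ->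
    nonvanishing (stail z.1) (fun j => cons_section x (z.2 j)).
  move=> z; have [/nonvanishing_section[x xz]|nz] := pselect (nonvanishing z.1 z.2).
    by exists x.
  by exists point.
pose step (z : Z) : Z := (stail z.1, fun j => cons_section (X z) (z.2 j)).
have Xs n : forall z, nonvanishing z.1 z.2 -> nonvanishing (iter n step z).1 (iter n step z).2.
  by elim: n => //= n IH z /IH/XP.
have lift n : forall (z : Z) j (w : seqT), (iter n step z).2 j w -> exists2 w' : seqT,
    (forall i, (i < n)%N -> w' i = X (iter i step z)) & z.2 j w'.
  elim: n => [z j w zw|n IH z j w]; first by exists w.
  rewrite iterSr => /IH[w' w'X zw']; exists (scons (X z, w')) => // -[|i]//= ni.
  by rewrite -iterS iterSr; exact: w'X.
pose z0 : Z := (s, B).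
exists (fun i => X (iter i step z0)) => j.
have [cB _ _] := sB; have [_ [n nB]] := cB j.
have [cBn _ [e e0 /(_ j)]] := Xs n z0 sB.
have [->|/set0P[w /lift[w' w'X Bw']] _] := eqVneq ((iter n step z0).2 j) set0.
  by rewrite cyl_content0 lee_fin leNgt e0.
exact: nB Bw'.
Qed.

(** Continuity at the empty set, which is [nonvanishing_bigcap], makes the
    finitely additive content sigma-additive. *)
Lemma cyl_content_sigma_additive s : semi_sigma_additive (cyl_content s).
Proof.
move=> F mF tF mU.
pose U := \bigcup_n F n.
pose B n := U `\` \big[setU/set0]_(i < n) F i.
have cS n : cylinder (\big[setU/set0]_(i < n) F i).
  apply: (big_ind cylinder) => [|A A'|i _]; last exact: mF.
    exact: cylinder0.
  exact: cylinderU.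
have cD A A' : cylinder A -> cylinder A' -> cylinder (A `\` A').
  move=> cA cA'; rewrite setDE -[A]setCK -setCU.
  by apply: cylinderC; apply: cylinderU => //; exact: cylinderC.
have cB n : cylinder (B n) by exact: cD.
have FB n : B n = F n `|` B n.+1.
  rewrite /B big_ord_recr/=; apply/seteqP; split => w /=.
    move=> [Uw nw]; have [Fw|nF] := pselect (F n w); [by left|right].
    by split => // -[].
  move=> [Fw|[Uw nw]]; split => //.
  - by exists n.
  - rewrite -(bigcup_mkord n F) => -[k kn Fk]; move/trivIsetP: tF => /(_ k n I I).
    by rewrite neq_ltn kn => /(_ isT)/seteqP[+ _] => /(_ w); apply.
  - by move=> h; apply: nw; left.
have FB0 n : F n `&` B n.+1 = set0.
  rewrite /B big_ord_recr/=; apply/seteqP; split => w //= -[Fw [_]].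
  by apply; right.
(* the contents of the remainders B n are what the partial sums miss *)
have sE n : cyl_content s U = ((\sum_(0 <= i < n) cyl_content s (F i)) + cyl_content s (B n))%E.
  elim: n => [|n IH]; first by rewrite big_geq// add0e /B big_ord0 setD0.
  rewrite IH big_nat_recr//= -addeA -cyl_contentU//; last exact: mF.
  by rewrite -FB.
have small (e : R) : 0 < e -> exists n, (cyl_content s (B n) < e%:E)%E.
  move=> e0; apply: contrapT => /forallNP h.
  have [|w Bw] := @nonvanishing_bigcap s B.
    split => //; first by move=> j w Bw; rewrite (FB j); right.
    by exists e => // j; rewrite leNgt; apply/negP/h.
  have [[n _ Fnw] _] := Bw 0%N.
  have [_] := Bw n.+1; apply; rewrite -(bigcup_mkord n.+1 F); exists n => //=.
have dB n m : (n <= m)%N -> (cyl_content s (B m) <= cyl_content s (B n))%E.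
  move=> /subnK <-; elim: (m - n)%N => [|k IH]; first by rewrite lexx.
  apply: le_trans IH.
  have -> : cyl_content s (B (k + n)%N) =
      (cyl_content s (F (k + n)%N) + cyl_content s (B (k + n).+1))%E.
    by rewrite -cyl_contentU// -?FB//; exact: mF.
  by rewrite addSn leeDr// cyl_content_ge0.
have cU : cylinder U by exact: mU.
rewrite -/U -(fineK (cyl_content_fin s cU)).
apply/fine_cvgP; split.
  by apply: nearW => n; apply/sum_fin_numP => i _ _; apply: cyl_content_fin; exact: mF.
apply/cvgrPdist_lt => e /small[n Bn]; near=> m.
have fS : (\sum_(0 <= i < m) cyl_content s (F i))%E \is a fin_num.
  by apply/sum_fin_numP => i _ _; apply: cyl_content_fin; exact: mF.
rewrite /= (sE m) fineD ?cyl_content_fin// addrAC subrr add0r.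
rewrite ger0_norm ?fine_ge0 ?cyl_content_ge0//.
rewrite -lte_fin fineK ?cyl_content_fin//.
by apply: le_lt_trans Bn; apply: dB; near: m; exists n.
Unshelve. all: by end_near. Qed.

HB.instance Definition _ s := isMeasure.Build _ _ _ (cyl_content s)
  (cyl_content0 s) (@cyl_content_ge0 s) (@cyl_content_sigma_additive s).

Definition cyl_sigmaT :=
  g_sigma_algebraType (@measurable _ cylT : set (set cylT)).

Definition cyl_extension (s : nat -> probability V R) :
    set cyl_sigmaT -> \bar R := measure_extension (cyl_content s).

HB.instance Definition _ s := Measure.on (cyl_extension s).

Lemma cyl_extensionE s A : cylinder A -> cyl_extension s A = cyl_content s A.
Proof. by move=> cA; rewrite /cyl_extension /measure_extension measurable_mu_extE. Qed.

Lemma cylinderT : cylinder setT.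
Proof. by rewrite -setC0; exact/cylinderC/cylinder0. Qed.

Lemma cyl_extension_setT s : cyl_extension s setT = 1%E.
Proof.
by rewrite cyl_extensionE ?(@cyl_contentE 0)// ?probability_setT//; exact: cylinderT.
Qed.

HB.instance Definition _ s := Measure_isProbability.Build _ _ _
  (cyl_extension s) (cyl_extension_setT s).

Lemma coordinate_cylinder : coordinate_sets `<=` cylinder.
Proof.
move=> _ [n [B [mB ->]]]; split.
  by apply: sub_sigma_algebra; exists n, B.
by exists n.+1 => w w' ww' /=; rewrite (ww' n).
Qed.

Definition of_cyl_sigma (w : cyl_sigmaT) : seqT := w.

Lemma measurable_of_cyl_sigma : measurable_fun [set: cyl_sigmaT] of_cyl_sigma.
Proof.
apply: (@measurability _ _ _ seqT _ _ coordinate_sets) => // _ [A cA <-].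
by rewrite setTI; apply: sub_sigma_algebra; exact: coordinate_cylinder.
Qed.

HB.instance Definition _ := isMeasurableFun.Build _ _ _ _ of_cyl_sigma
  measurable_of_cyl_sigma.

(** The extension of the cylinder content, read on the sigma-algebra generated
    by the coordinates. *)
Definition iprod (s : nat -> probability V R) : probability seqT R :=
  distribution (cyl_extension s) of_cyl_sigma.

Lemma iprod_cylinder s A : cylinder A -> iprod s A = cyl_content s A.
Proof. exact: cyl_extensionE. Qed.

(** Independence of the first coordinate from the others. *)
Lemma iprod_scons s A : measurable A ->
  iprod s A = (s 0%N \x iprod (stail s))%E (scons @^-1` A).
Proof.
move=> mA; rewrite -[RHS]/(distribution (s 0%N \x iprod (stail s))%E scons A).
apply: (@g_sigma_algebra_measure_unique _ _ _ cylinder _ (fun=> setT)).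
- by move=> B [].
- by move=> _; exact: cylinderT.
- by rewrite bigcup_const.
- move=> B C cB cC; rewrite -[_ `&` _]setCK setCI; apply: cylinderC.
  by apply: cylinderU; exact: cylinderC.
- move=> B cB; transitivity (cyl_content s B); first exact: iprod_cylinder.
  rewrite cyl_content_section//.
  rewrite /distribution/pushforward/= /product_measure1; apply: eq_integral => x _ /=.
  rewrite -iprod_cylinder; last exact: cylinder_cons_section.
  by congr (iprod _ _); apply/seteqP; split => w; rewrite /xsection/= in_setE.
- by move=> _; rewrite (le_lt_trans (probability_le1 (iprod s) measurableT))// ltry.
- by move: A mA; apply: sub_sigma_algebra2 => B; exact: coordinate_cylinder.
Qed.

Lemma iprod_coord n s B : measurable B -> iprod s [set w | B (w n)] = s n B.
Proof.
move=> mB.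
have mC k : measurable ([set w | B (w k)] : set seqT).
  by have [] := @coordinate_cylinder ((fun w => w k) @^-1` B); first by exists k, B.
elim: n s => [|n IH] s; rewrite iprod_scons//.
  rewrite (_ : _ @^-1` _ = B `*` setT); last by apply/seteqP; split => // z [].
  rewrite product_measure1E// [X in (_ * X)%E](_ : _ = 1%E) ?mule1//.
  exact: probability_setT.
rewrite (_ : _ @^-1` _ = setT `*` [set w | B (w n)]); last first.
  by apply/seteqP; split => [//|z []].
rewrite product_measure1E// [X in (X * _)%E](_ : _ = 1%E) ?mul1e.
  exact: (IH (stail s)).
exact: probability_setT.
Qed.

End InfiniteProduct.

(** * The convolution monoid of laws *)

Lemma additive0 (U W : zmodType) (f : U -> W) : {morph f : x y / x + y} -> f 0 = 0.
Proof. by move=> fD; apply: (addrI (f 0)); rewrite -fD !addr0. Qed.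

Section Laws.
Context (R : realType) (V : sctGroup).
Local Notation prob := (probability (borel V) R).

Lemma eq_prob_refl (mu : prob) : eq_prob mu mu.
Proof. by []. Qed.

(** Two probabilities that agree on measurable sets may differ elsewhere, so
    convolution is a commutative monoid only up to [eq_prob]. A chosen
    representative of each class makes it one for Leibniz equality, and gives
    access to the theory of big operators. *)
Definition class_repr (mu : prob) : prob :=
  sval (cid (ex_intro (eq_prob mu) mu (eq_prob_refl mu))).

Lemma class_reprP mu : eq_prob mu (class_repr mu).
Proof. by rewrite /class_repr; case: cid. Qed.

Lemma eq_class_repr mu nu : eq_prob mu nu -> class_repr mu = class_repr nu.
Proof.
move=> munu; have cidE (P Q : prob -> Prop) p q : P = Q ->
    sval (@cid _ P p) = sval (@cid _ Q q).
  by move=> PQ; subst Q; rewrite (Prop_irrelevance p q).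
apply: cidE; apply/funext => l; apply/propext.
by split => h B mB; rewrite -h// munu.
Qed.

Definition law := {mu : prob | class_repr mu = mu}.
Definition to_law (mu : prob) : law :=
  exist _ (class_repr mu) (esym (eq_class_repr (@class_reprP mu))).
Definition of_law (l : law) : prob := sval l.
Local Coercion of_law : law >-> Probability.type.

Lemma to_lawE mu B : measurable B -> to_law mu B = mu B.
Proof. by move=> mB; rewrite /= -class_reprP. Qed.

Lemma lawP (l l' : law) : (forall B, measurable B -> l B = l' B) -> l = l'.
Proof.
case: l l' => [mu mu1] [nu nu1] /= /eq_class_repr; rewrite mu1 nu1 => E.
by subst nu; rewrite (Prop_irrelevance mu1 nu1).
Qed.

Lemma eq_to_law mu nu : eq_prob mu nu <-> to_law mu = to_law nu.
Proof.
split=> [munu|E B mB]; last by rewrite -[LHS]to_lawE// E to_lawE.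
by apply: lawP => B mB; rewrite !to_lawE// munu.
Qed.

Lemma of_lawK l : to_law (of_law l) = l.
Proof. by apply: lawP => B mB; rewrite to_lawE. Qed.

Definition shift_preimage (x : V) (B : set (borel V)) : set (borel V) :=
  [set y : borel V | B ((x + (y : V)) : V)].

Lemma measurable_shift_preimage x B : measurable B -> measurable (shift_preimage x B).
Proof.
move=> mB; rewrite -[X in measurable X]setTI.
have /(_ measurableT B mB)// := measurableT_comp (@borel_add_measurable V)
  (measurable_pair1 (x : borel V)).
Qed.

Lemma shift_preimage_xsection (x : borel V) B : xsection (@borel_add V @^-1` B) x =
  shift_preimage x B.
Proof. by apply/seteqP; split => w; rewrite /xsection/= in_setE. Qed.

(** The general formula that reduces statements on convolutions to integrals
    of one variable. *)
Lemma convolutionE (mu nu : prob) B :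
  convolution mu nu B = (\int[mu]_x nu (shift_preimage x B))%E.
Proof.
rewrite /convolution/distribution/pushforward/= /product_measure1.
by apply: eq_integral => x _ /=; rewrite shift_preimage_xsection.
Qed.

Lemma measurable_prob_shift (nu : prob) B : measurable B ->
  measurable_fun [set: borel V] ((fun x => nu (shift_preimage x B)) : borel V -> \bar R).
Proof.
move=> mB; have mA : measurable (@borel_add V @^-1` B).
  by rewrite -[X in measurable X]setTI; exact: borel_add_measurable.
rewrite (_ : (fun x => _) = nu \o xsection (@borel_add V @^-1` B)).
  exact: measurable_fun_xsection.
by apply/funext => x /=; rewrite shift_preimage_xsection.
Qed.

Lemma eq_prob_integral (mu nu : prob) (f : borel V -> \bar R) :
  eq_prob mu nu -> (\int[mu]_x f x = \int[nu]_x f x)%E.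
Proof. by move=> munu; apply: eq_measure_integral => A mA _; exact: munu. Qed.

Definition conv (l l' : law) : law := to_law (convolution l l').
Definition law1 : law := to_law (dirac_at_0 R V).

Lemma convE l l' B : measurable B -> conv l l' B = (\int[l]_x l' (shift_preimage x B))%E.
Proof. by move=> mB; rewrite to_lawE// convolutionE. Qed.

Lemma law1E B : measurable B -> law1 B = (\1_B (0 : V))%:E.
Proof. by move=> mB; rewrite to_lawE. Qed.

Lemma to_law_conv mu nu : to_law (convolution mu nu) = conv (to_law mu) (to_law nu).
Proof.
apply: lawP => B mB; rewrite to_lawE// convE// convolutionE.
rewrite (eq_prob_integral _ (@class_reprP mu)).
by apply: eq_integral => x _; rewrite to_lawE//; exact: measurable_shift_preimage.
Qed.

Lemma convC : commutative conv.
Proof.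
move=> l l'; apply: lawP => B mB; rewrite convE//.
transitivity (convolution l' l B); last by rewrite to_lawE.
have mA : measurable (@borel_add V @^-1` B).
  by rewrite -[X in measurable X]setTI; exact: borel_add_measurable.
transitivity ((l' \x^ l)%E (@borel_add V @^-1` B)).
  rewrite /= /product_measure2; apply: eq_integral => x _ /=.
  congr (of_law _ _); apply/seteqP; split => w.
    by rewrite /ysection/= in_setE /borel_add/= /shift_preimage/= addrC.
  by rewrite /ysection/= in_setE /borel_add/= /shift_preimage/= addrC.
apply/esym/product_measure_unique => //.
by move=> A1 A2 mA1 mA2; exact: product_measure2E.
Qed.

Lemma conv1l : left_id law1 conv.
Proof.
move=> l; apply: lawP => B mB; rewrite convE//.
rewrite -(eq_prob_integral _ (@class_reprP (dirac_at_0 R V))).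
rewrite integral_dirac//; last exact: measurable_prob_shift.
rewrite diracT mul1e; congr (of_law _ _).
by apply/seteqP; split => x; rewrite /shift_preimage/= add0r.
Qed.

Lemma convA : associative conv.
Proof.
move=> l1 l2 l3; apply: lawP => B mB; rewrite [RHS]convE// [LHS]convE//.
rewrite -(eq_prob_integral _ (@class_reprP (convolution l1 l2))).
rewrite ge0_integral_distribution//; last exact: measurable_prob_shift.
rewrite fubini_tonelli1//; last first.
  exact: (measurableT_comp (measurable_prob_shift l3 mB) (@borel_add_measurable V)).
apply: eq_integral => x _; rewrite -/(of_law (conv l2 l3)).
rewrite convE; last exact: measurable_shift_preimage.
apply: eq_integral => y _; congr (of_law _ _).
by apply/seteqP; split => z; rewrite /shift_preimage/= addrA.
Qed.

HB.instance Definition _ := Monoid.isComLaw.Build law law1 conv convA convC conv1l.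

Definition is_image (f : V -> V) (l l' : law) :=
  forall B, measurable B -> l' B = l (f @^-1` B).

(** A total function of [f], so that images under composites need no bundling;
    the value for non-measurable [f] is arbitrary. *)
Definition image_law (f : V -> V) (l : law) : law :=
  if pselect (exists l', is_image f l l') is left h then sval (cid h) else l.

Lemma ex_image (f : {mfun borel V >-> borel V}) l : is_image f l (to_law (distribution l f)).
Proof. by move=> B mB; rewrite to_lawE. Qed.

Lemma image_lawP (f : V -> V) l :
  measurable_fun [set: borel V] (f : borel V -> borel V) -> is_image f l (image_law f l).
Proof.
move=> mf; rewrite /image_law; case: pselect => [h|]; first exact: svalP (cid h).
case; pose g : {mfun borel V >-> borel V} :=
  HB.pack (f : borel V -> borel V) (isMeasurableFun.Build _ _ _ _ _ mf).
by exists (to_law (distribution l g)); exact: ex_image.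
Qed.

Lemma image_law_to_law (T : contractive_automorphism V) mu :
  to_law (image_prob T mu) = image_law T (to_law mu).
Proof.
have mT := continuous_borel_measurable (@contraction_continuous V T).
apply: lawP => B mB; rewrite to_lawE// image_lawP// to_lawE//.
by rewrite -[X in measurable X]setTI; exact: mT.
Qed.

Section Image.
Variables (f : V -> V).
Hypothesis mf : measurable_fun [set: borel V] (f : borel V -> borel V).
Hypothesis fD : {morph f : x y / x + y}.

Lemma image_lawE l B : measurable B -> image_law f l B = l (f @^-1` B).
Proof. exact: image_lawP. Qed.

Lemma measurable_preimage_fun B : @measurable _ (borel V) B -> @measurable _ (borel V) (f @^-1` B).
Proof. by move=> mB; rewrite -[X in measurable X]setTI; exact: mf. Qed.

Lemma integral_image_law l (g : borel V -> \bar R) :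
  measurable_fun [set: borel V] g -> (forall x, 0 <= g x)%E ->
  (\int[image_law f l]_x g x = \int[l]_x g (f x))%E.
Proof.
move=> mg g0; pose F : {mfun borel V >-> borel V} :=
  HB.pack (f : borel V -> borel V) (isMeasurableFun.Build _ _ _ _ _ mf).
rewrite (@eq_prob_integral _ (distribution l F)); last by move=> B mB; rewrite image_lawE.
by rewrite ge0_integral_distribution.
Qed.

Lemma image_law_conv l l' : image_law f (conv l l') = conv (image_law f l) (image_law f l').
Proof.
apply: lawP => B mB; rewrite image_lawE// !convE//; last exact: measurable_preimage_fun.
rewrite integral_image_law//; last exact: measurable_prob_shift.
apply: eq_integral => x _; rewrite image_lawE; last exact: measurable_shift_preimage.
by congr (of_law _ _); apply/seteqP; split => y; rewrite /shift_preimage/= fD.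
Qed.

Lemma image_law1 : image_law f law1 = law1.
Proof.
apply: lawP => B mB; rewrite image_lawE// !law1E//; last exact: measurable_preimage_fun.
have f0 : f 0 = 0 := additive0 fD.
by rewrite !indicE; congr ((nat_of_bool _)%:R%:E); apply/idP/idP; rewrite !inE/= f0.
Qed.

Lemma image_law_big (I : Type) (r : seq I) (P : pred I) (F : I -> law) :
  image_law f (\big[conv/law1]_(i <- r | P i) F i) =
  \big[conv/law1]_(i <- r | P i) image_law f (F i).
Proof. by apply: (big_morph (image_law f)); [exact: image_law_conv|exact: image_law1]. Qed.

End Image.

Lemma to_law_big (I : Type) (r : seq I) (P : pred I) (F : I -> prob) :
  to_law (\big[@convolution R V/dirac_at_0 R V]_(i <- r | P i) F i) =
  \big[conv/law1]_(i <- r | P i) to_law (F i).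
Proof. by apply: (big_morph to_law); [exact: to_law_conv|]. Qed.

End Laws.
Coercion of_law : law >-> Probability.type.

(** * Tails of laws for a translation invariant norm *)

(** A complete translation invariant metric that induces the topology, given
    by the distance to 0; the probabilistic part of the proof depends on the
    space only through it. *)
Record group_norm (R : realType) (V : sctGroup) := GroupNorm {
  gn :> V -> R;
  gn_ge0 : forall x, 0 <= gn x;
  gn0 : gn 0 = 0;
  gn_eq0 : forall x, gn x = 0 -> x = 0;
  gnN : forall x, gn (- x) = gn x;
  gnD : forall x y, gn (x + y) <= gn x + gn y;
  gn_nbhs : forall (x : V) (A : set V),
    nbhs x A <-> exists2 e : R, 0 < e & forall y, gn (y - x) < e -> A y;
  gn_complete : forall u : nat -> V,
    (forall e, 0 < e -> exists n, forall k, (n <= k)%N -> gn (u k - u n) < e) ->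
    exists l, forall e, 0 < e -> exists n, forall k, (n <= k)%N -> gn (u k - l) < e }.

Section Pr.
Context (R : realType) (V : sctGroup).
Implicit Types l : law R V.

Definition mass l (A : set (borel V)) : R := fine (l A).

Lemma massE l A : measurable A -> l A = (mass l A)%:E.
Proof. by move=> mA; rewrite fineK// fin_num_measure. Qed.

Lemma mass_ge0 l A : 0 <= mass l A.
Proof. by rewrite fine_ge0. Qed.

Lemma mass_le1 l A : measurable A -> mass l A <= 1.
Proof. by move=> mA; rewrite -lee_fin -massE// probability_le1. Qed.

Lemma massC l A : measurable A -> mass l (~` A) = 1 - mass l A.
Proof.
move=> mA; apply: EFin_inj; rewrite -massE; last exact: measurableC.
by rewrite probability_setC// massE// EFinB.
Qed.

Lemma mass_le l A B : measurable A -> measurable B -> A `<=` B -> mass l A <= mass l B.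
Proof. by move=> mA mB AB; rewrite -lee_fin -!massE// le_measure ?inE. Qed.

(** If [x] has law [l1] and [y] has law [l2] independently, then two disjoint
    rectangles of pairs [(x, y)] whose sums lie in [C] contribute additively
    to the mass of [C]. *)
Lemma conv_rect2 l1 l2 (A1 A2 B1 B2 C : set (borel V)) : measurable A1 -> measurable A2 ->
  measurable B1 -> measurable B2 -> measurable C ->
  A1 `&` B1 = set0 ->
  (forall x y : V, A1 x -> A2 y -> C (x + y)) ->
  (forall x y : V, B1 x -> B2 y -> C (x + y)) ->
  mass l1 A1 * mass l2 A2 + mass l1 B1 * mass l2 B2 <= mass (conv l1 l2) C.
Proof.
move=> mA1 mA2 mB1 mB2 mC AB AC BC.
have mD : measurable (@borel_add V @^-1` C).
  by rewrite -[X in measurable X]setTI; exact: borel_add_measurable.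
rewrite -lee_fin -[leRHS]massE// to_lawE// EFinD !EFinM -!massE//.
rewrite -!product_measure1E// -measureU//; last 3 first.
- exact: measurableX.
- exact: measurableX.
- by apply/seteqP; split => // z [[A1z _] [B1z _]]; have : (A1 `&` B1) z.1 by []; rewrite AB.
apply: le_measure; rewrite ?inE//.
  by apply: measurableU; exact: measurableX.
by move=> [x y] [] [/=]; [exact: AC|exact: BC].
Qed.

Lemma conv_rect l1 l2 (A1 A2 C : set (borel V)) : measurable A1 -> measurable A2 -> measurable C ->
  (forall x y : V, A1 x -> A2 y -> C (x + y)) ->
  mass l1 A1 * mass l2 A2 <= mass (conv l1 l2) C.
Proof.
move=> mA1 mA2 mC AC.
have := @conv_rect2 l1 l2 A1 A2 set0 set0 C mA1 mA2 measurable0 measurable0 mC.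
rewrite setI0 => /(_ erefl AC) h.
by apply: le_trans (h _) => //; rewrite lerDl mulr_ge0// mass_ge0.
Qed.

End Pr.

Section Tail.
Context (R : realType) (V : sctGroup) (N : group_norm R V).
Implicit Types l : law R V.

Lemma gn_sub (x y : V) : N x <= N y + N (x - y).
Proof. by apply: le_trans (gnD _ _ _); rewrite addrC subrK. Qed.

Lemma gnBC (x y : V) : N (x - y) = N (y - x).
Proof. by rewrite -gnN opprB. Qed.

Lemma gn_open (A : set V) :
  (forall x, A x -> exists2 e : R, 0 < e & forall y, N (y - x) < e -> A y) -> open A.
Proof. by move=> h; rewrite openE => x /h /(gn_nbhs N x A). Qed.

Lemma measurable_open (A : set (borel V)) : open (A : set V) -> measurable A.
Proof. by move=> oA; apply: sub_sigma_algebra. Qed.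

Lemma measurable_gn_gt e : measurable ([set x | e < N x] : set (borel V)).
Proof.
apply: measurable_open; apply: gn_open => x /= ex.
exists (N x - e); rewrite ?subr_gt0// => y yx.
have := gn_sub x y; rewrite gnBC; lra.
Qed.

Lemma measurable_gn_lt e : measurable ([set x | N x < e] : set (borel V)).
Proof.
apply: measurable_open; apply: gn_open => x /= ex.
exists (e - N x); rewrite ?subr_gt0// => y yx.
have := gn_sub y x; lra.
Qed.

Lemma gn_leE e : [set x | N x <= e] = ~` [set x | e < N x].
Proof. by apply/seteqP; split => x /=; rewrite leNgt => /negP. Qed.

Lemma measurable_gn_le e : measurable ([set x | N x <= e] : set (borel V)).
Proof. by rewrite gn_leE; apply: measurableC; exact: measurable_gn_gt. Qed.

#[local] Hint Resolve measurable_gn_gt measurable_gn_lt measurable_gn_le : core.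

Definition tail l e : R := mass l [set x | e < N x].

Lemma tail_ge0 l e : 0 <= tail l e.
Proof. exact: mass_ge0. Qed.

Lemma tail_le1 l e : tail l e <= 1.
Proof. exact: mass_le1. Qed.

Lemma mass_gn_le l e : mass l [set x | N x <= e] = 1 - tail l e.
Proof. by rewrite gn_leE massC. Qed.

Lemma tail_le l a b : a <= b -> tail l b <= tail l a.
Proof. by move=> ab; apply: mass_le => // x /=; exact: le_lt_trans. Qed.

(** Every law is tight for the norm, since the norm is finite everywhere. *)
Lemma tail_small l (d : R) : 0 < d -> exists2 a, 0 < a & tail l a < d.
Proof.
move=> d0; pose F n : set (borel V) := [set x | n%:R < N x].
have : l \o F @ \oo --> l (\bigcap_n F n).
  apply: nonincreasing_cvg_mu.
  - by rewrite (le_lt_trans (probability_le1 _ _))// ?ltry//; exact: measurable_gn_gt.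
  - by move=> i; exact: measurable_gn_gt.
  - by apply: bigcap_measurable => // i _; exact: measurable_gn_gt.
  - move=> n m nm; apply/subsetPset => x; rewrite /F/=; apply: le_lt_trans.
    by rewrite ler_nat.
rewrite (_ : \bigcap_n F n = set0) ?measure0; last first.
  apply/seteqP; split => // x /(_ (Num.truncn (N x)).+1 I); rewrite /F/=.
  by move/(lt_trans (truncnS_gt _)); rewrite ltxx.
move=> /fine_cvgP[_ /cvgrPdist_lt/(_ d d0)[n _ /(_ n.+1 (leqnSn _))]].
rewrite /= sub0r normrN ger0_norm ?fine_ge0// => h.
by exists n.+1%:R.
Qed.

Lemma tail_law1 e : 0 <= e -> tail (law1 R V) e = 0.
Proof.
move=> e0; rewrite /tail/mass law1E//= indicE memNset//= gn0.
by apply/negP; rewrite -leNgt.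
Qed.

(** The sum is large if one summand is and the other is not; the two cases are
    disjoint. This is a substitute for the symmetrisation inequalities of
    probability theory. *)
Lemma tail_conv_ge l1 l2 r a : 0 <= r ->
  tail l1 (r + a) * (1 - tail l2 a) + (1 - tail l1 a) * tail l2 (r + a) <=
  tail (conv l1 l2) r.
Proof.
move=> r0; rewrite -!mass_gn_le; apply: conv_rect2 => //.
- apply/seteqP; split => // x [/= h1 h2].
  have : a < a by apply: lt_le_trans h2; apply: le_lt_trans h1; rewrite lerDr.
  by rewrite ltxx.
- move=> x y /= h1 h2; have := gn_sub x (- y); rewrite opprK gnN; lra.
- move=> x y /= h1 h2; have := gn_sub y (- x); rewrite opprK gnN (addrC y); lra.
Qed.

Lemma tail_conv_le l1 l2 a b : tail (conv l1 l2) (a + b) <= tail l1 a + tail l2 b.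
Proof.
have : mass l1 [set x | N x <= a] * mass l2 [set x | N x <= b] <=
    mass (conv l1 l2) [set x | N x <= a + b].
  by apply: conv_rect => //= x y xa yb; apply: le_trans (gnD _ _ _) _; exact: lerD.
rewrite !mass_gn_le; have := tail_ge0 l1 a; have := tail_ge0 l2 b; nra.
Qed.

Lemma tail_big_le (I : eqType) (s : seq I) (F : I -> law R V) c q : 0 <= c ->
  (forall i, i \in s -> tail (F i) c <= q) ->
  tail (\big[@conv R V/law1 R V]_(i <- s) F i) ((size s)%:R * c) <= (size s)%:R * q.
Proof.
move=> c0; elim: s => [_|i s IH sq]; first by rewrite big_nil !mul0r tail_law1.
rewrite big_cons /= -natr1 mulrDl mul1r addrC; apply: le_trans (tail_conv_le _ _ _ _) _.
rewrite mulrDl mul1r addrC lerD//; last by apply: sq; rewrite mem_head.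
by apply: IH => j js; apply: sq; rewrite in_cons js orbT.
Qed.

Definition thicken (e : R) (C : set V) : set V :=
  [set y | exists2 x, C x & N (y - x) < e].

Lemma measurable_thicken e C : measurable (thicken e C : set (borel V)).
Proof.
apply: measurable_open; apply: gn_open => y [x Cx yx].
exists (e - N (y - x)); rewrite ?subr_gt0// => z zy; exists x => //.
by have := gnD N (z - y) (y - x); rewrite addrA subrK; lra.
Qed.

(** A closed set is the intersection of its neighbourhoods. *)
Lemma thicken_cvg l (C : set V) (d : R) : closed C -> 0 < d ->
  exists2 e : R, 0 < e & mass l (thicken e C) < mass l (C : set (borel V)) + d.
Proof.
move=> cC d0; pose F n : set (borel V) := thicken n.+1%:R^-1 C.
have mC : measurable (C : set (borel V)).
  by rewrite -[C]setCK; apply: measurableC; apply: measurable_open; exact: closed_openC.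
have FC : \bigcap_n F n = C.
  apply/seteqP; split => [y Fy|y Cy n _]; last by exists y; rewrite // subrr gn0.
  apply: cC => A /(gn_nbhs N y A)[e e0 eA].
  pose n := Num.truncn e^-1.
  have ne : n.+1%:R^-1 < e by rewrite invf_plt ?posrE// truncnS_gt.
  have [x Cx yx] := Fy n I; exists x; split => //; apply: eA.
  by rewrite gnBC (lt_trans yx).
have : l \o F @ \oo --> l (\bigcap_n F n).
  apply: nonincreasing_cvg_mu.
  - by rewrite (le_lt_trans (probability_le1 _ _))// ?ltry//; exact: measurable_thicken.
  - by move=> i; exact: measurable_thicken.
  - by rewrite FC.
  - move=> n m nm; apply/subsetPset => y [x Cx yx]; exists x => //.
    by apply: (lt_le_trans yx); rewrite lef_pV2 ?posrE// ler_nat.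
rewrite FC (massE l mC) => /fine_cvgP[_ /cvgrPdist_lt/(_ d d0)[n _ /(_ n (leqnn _))]] /= h.
exists n.+1%:R^-1 => //; move: h; rewrite ltr_norml => /andP[h _].
by rewrite -ltrBlDl -ltrN2 opprB.
Qed.

(** Convolving with a law close to the unit mass at 0 moves little mass out of
    a neighbourhood of [C]. *)
Lemma limit_le l1 l2 (rho tau : nat -> law R V) (C : set V) :
  (forall n, conv l1 (rho n) = conv l2 (tau n)) ->
  (forall e d, 0 < e -> 0 < d -> exists n, tail (rho n) e < d /\ tail (tau n) e < d) ->
  closed C -> mass l1 (C : set (borel V)) <= mass l2 (C : set (borel V)).
Proof.
move=> E small cC; rewrite leNgt; apply/negP => lt21.
have mC : measurable (C : set (borel V)).
  by rewrite -[C]setCK; apply: measurableC; apply: measurable_open; exact: closed_openC.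
pose d := (mass l1 (C : set (borel V)) - mass l2 (C : set (borel V))) / 4.
have d0 : 0 < d by rewrite divr_gt0// subr_gt0.
have [e e0 eC] := thicken_cvg l2 cC d0.
have e40 : 0 < e / 4 by rewrite divr_gt0.
have [n [rn tn]] := small _ _ e40 d0.
have h1 : mass l1 C * (1 - tail (rho n) (e / 4)) <=
    mass (conv l1 (rho n)) (thicken (e / 2) C).
  rewrite -mass_gn_le; apply: conv_rect => //; first exact: measurable_thicken.
  by move=> x y Cx /= ye; exists x => //; rewrite addrAC subrr add0r; lra.
have h2 : (1 - mass l2 (thicken e C)) * (1 - tail (tau n) (e / 4)) <=
    1 - mass (conv l2 (tau n)) (thicken (e / 2) C).
  rewrite -mass_gn_le -!massC; try exact: measurable_thicken.
  apply: conv_rect => //; try by apply: measurableC; exact: measurable_thicken.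
  move=> x y Cx /= ye [z Cz xyz]; apply: Cx; exists z => //.
  have := gnD N (x + y - z) (- y); rewrite addrAC addrK gnN; lra.
have h3 : mass l1 (C : set (borel V)) = mass l2 (C : set (borel V)) + 4 * d.
  by rewrite /d mulrC divfK ?pnatr_eq0// addrC subrK.
move: h1 h2; rewrite E h3 => h1 h2.
have := tail_ge0 (rho n) (e / 4); have := tail_ge0 (tau n) (e / 4).
have := mass_ge0 l2 (C : set (borel V)); have := mass_ge0 l2 (thicken e C).
have := mass_le1 l2 (measurable_thicken e C).
have := mass_le1 l1 mC; rewrite h3.
move: h1 h2 eC rn tn.
set t1 := tail _ _; set t2 := tail _ _; set p := mass l2 (C : set _).
set q := mass l2 (thicken _ _); set r := mass _ (thicken _ _).
move=> h1 h2 eC rn tn p1 q1 q0 p0 t10 t20.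
have : (p + 4 * d) * t1 <= t1 by nra.
have : (1 - q) * t2 <= t2 by nra.
by lra.
Qed.

(** Replaces weak convergence: if [rho n] and [tau n] tend to the unit mass at
    0, then both sides of the identity tend to [l1] and [l2]. *)
Lemma limit_unique l1 l2 (rho tau : nat -> law R V) :
  (forall n, conv l1 (rho n) = conv l2 (tau n)) ->
  (forall e d, 0 < e -> 0 < d -> exists n, tail (rho n) e < d /\ tail (tau n) e < d) ->
  l1 = l2.
Proof.
move=> E small.
have eqC (C : set V) : closed C -> mass l1 (C : set (borel V)) = mass l2 (C : set (borel V)).
  move=> cC; apply/le_anti; rewrite (limit_le E)//=.
  apply: (@limit_le l2 l1 tau rho) => // e d e0 d0.
  by have [n [? ?]] := small e d e0 d0; exists n.
apply: lawP; apply: (@g_sigma_algebra_measure_unique _ _ (borel V)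
  (@open V : set (set (borel V))) _ (fun=> setT)).
- by move=> A; exact: measurable_open.
- by move=> _; exact: openT.
- by rewrite bigcup_const.
- by move=> A B oA oB; exact: openI.
- move=> A oA; have mA := measurable_open oA.
  have : mass l1 (~` A) = mass l2 (~` A) by apply: eqC; exact: open_closedC.
  rewrite !massC// => h; transitivity (mass l1 A)%:E; first exact: massE.
  transitivity (mass l2 A)%:E; last exact/esym/massE.
  by congr EFin; lra.
- by move=> _; rewrite (le_lt_trans (probability_le1 _ measurableT))// ltry.
Qed.

End Tail.

(** * Convergent random series *)

Section RandomSeries.
Context (R : realType) (V : sctGroup) (N : group_norm R V).
Local Notation seqV := (seqT (borel V)).

Definition segment (w : nat -> V) i j : V := \sum_(i <= k < j) w k.

Definition sums_to (w : nat -> V) (l : V) := forall e : R, 0 < e ->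
  exists n, forall k, (n <= k)%N -> N (segment w 0 k - l) < e.

Definition summable (w : nat -> V) := exists l, sums_to w l.

Definition total (w : nat -> V) : V :=
  if pselect (summable w) is left h then sval (cid h) else 0.

Lemma gn_le_small (x : V) : (forall e : R, 0 < e -> N x <= e) -> x = 0.
Proof.
move=> h; apply/(gn_eq0 (g := N))/le_anti; rewrite gn_ge0 andbT.
by apply/ler_addgt0Pl => e /h; rewrite addr0.
Qed.

Lemma sums_to_unique w l l' : sums_to w l -> sums_to w l' -> l = l'.
Proof.
move=> wl wl'; apply/eqP; rewrite -subr_eq0; apply/eqP/gn_le_small => e e0.
have e20 : 0 < e / 2 by rewrite divr_gt0.
have [n1 h1] := wl _ e20; have [n2 h2] := wl' _ e20.
have := h1 (maxn n1 n2) (leq_maxl _ _); have := h2 (maxn n1 n2) (leq_maxr _ _).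
set p := segment _ _ _; have := gnD N (l - p) (p - l').
by rewrite addrA subrK (gnBC N l p); lra.
Qed.

Lemma totalP w : summable w -> sums_to w (total w).
Proof. by rewrite /total; case: pselect => // h _; exact: svalP (cid h). Qed.

Lemma total_eq w l : sums_to w l -> total w = l.
Proof. by move=> wl; apply: sums_to_unique (wl); apply: totalP; exists l. Qed.

Lemma total_not w : ~ summable w -> total w = 0.
Proof. by rewrite /total; case: pselect. Qed.

Definition prepend (x : V) (w : nat -> V) := fun n => if n is n'.+1 then w n' else x.

Lemma segment_prepend x w k : segment (prepend x w) 0 k.+1 = x + segment w 0 k.
Proof. by rewrite /segment big_nat_recl. Qed.

Lemma sums_to_prepend x w l : sums_to w l -> sums_to (prepend x w) (x + l).
Proof.
move=> wl e /wl[n h]; exists n.+1 => -[//|k]; rewrite ltnS => /h.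
by rewrite segment_prepend opprD addrACA subrr add0r.
Qed.

Lemma total_prepend x w : summable w -> total (prepend x w) = x + total w.
Proof. by move=> /totalP/sums_to_prepend-/(_ x)/total_eq. Qed.

(** The Cauchy criterion, with countably many conditions so that summability
    is a measurable event. *)
Lemma summableP w : summable w <->
  forall i, exists n, forall k, (n <= k)%N -> N (segment w n k) < i.+1%:R^-1.
Proof.
split=> [[l wl] i|h].
  have [|n nP] := wl (i.+1%:R^-1 / 2); first by rewrite divr_gt0.
  exists n => k nk; have := nP n (leqnn n); have := nP k nk.
  rewrite /segment (@big_cat_nat _ _ _ n)//=.
  set a := \sum_(0 <= _ < n) _; set b := \sum_(n <= _ < k) _.
  have ab : a + b - l + (l - a) = b by rewrite addrA subrK addrAC subrr add0r.
  have := gnD N (a + b - l) (l - a); rewrite ab (gnBC N l a).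
  set q := _%:R^-1; lra.
have [|l lP] := @gn_complete _ _ N (segment w 0); last by exists l.
move=> e e0; pose i := Num.truncn e^-1.
have ie : i.+1%:R^-1 < e by rewrite invf_plt ?posrE// truncnS_gt.
have [n nP] := h i; exists n => k nk.
rewrite /segment (@big_cat_nat _ _ _ n)//= addrAC subrr add0r.
exact: lt_trans (nP k nk) ie.
Qed.

Lemma measurable_addV d (T : measurableType d) (f g : T -> borel V) :
  measurable_fun setT f -> measurable_fun setT g ->
  measurable_fun setT ((fun t => (f t : V) + (g t : V) : V) : T -> borel V).
Proof.
move=> mf mg; have := measurableT_comp (@borel_add_measurable V) (measurable_fun_pair mf mg).
exact.
Qed.

Lemma measurable_segment i j :
  measurable_fun [set: seqV] ((fun w => segment w i j) : seqV -> borel V).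
Proof.
have [ij|ji] := leqP i j; last first.
  rewrite (_ : (fun w => _) = cst (0 : V)); first exact: measurable_cst.
  by apply/funext => w; rewrite /segment big_geq// ltnW.
rewrite -(subnKC ij); elim: (j - i)%N => [|k IH].
  rewrite (_ : (fun w => _) = cst (0 : V)); first exact: measurable_cst.
  by apply/funext => w; rewrite /segment big_geq// addn0.
rewrite (_ : (fun w => _) = fun w : seqV => segment w i (i + k) + w (i + k)%N).
  by apply: measurable_addV => //; exact: measurable_coord.
by apply/funext => w; rewrite /segment addnS big_nat_recr//= leq_addr.
Qed.

Lemma measurable_segment_pre i j (B : set (borel V)) : measurable B ->
  measurable ([set w | B (segment w i j)] : set seqV).
Proof.
by move=> mB; rewrite -[X in measurable X]setTI; exact: measurable_segment.
Qed.

Lemma measurable_summable : measurable ([set w | summable w] : set seqV).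
Proof.
rewrite (_ : [set w | _] = \bigcap_i \bigcup_n \bigcap_(k in [set k | (n <= k)%N])
   [set w : seqV | N (segment w n k) < i.+1%:R^-1]).
  apply: bigcapT_measurable => i; apply: bigcupT_measurable => n.
  apply: bigcap_measurableType => k _.
  exact: (measurable_segment_pre _ _ (measurable_gn_lt N i.+1%:R^-1)).
apply/seteqP; split => w /=.
  by move=> /summableP h i _; have [n nP] := h i; exists n => // k; exact: nP.
by move=> h; apply/summableP => i; have [n _ nP] := h i I; exists n.
Qed.

(** For open [U], a limit is in [U] when the sequence is eventually in one of
    these closed sets; this expresses membership of a limit by countably many
    conditions. *)
Definition erosion (U : set V) (e : R) : set V :=
  [set x | forall y, N (y - x) < e -> U y].

Lemma measurable_erosion U e : measurable (erosion U e : set (borel V)).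
Proof.
rewrite (_ : erosion U e = ~` thicken N e (~` U)).
  by apply: measurableC; exact: measurable_thicken.
apply/seteqP; split => [x h [y Uy xy]|x h y yx].
  by apply/Uy/h; rewrite gnBC.
by apply: contrapT => Uy; apply: h; exists y => //; rewrite gnBC.
Qed.

Lemma total_openE (U : set V) w : open U -> summable w ->
  (U (total w) <-> exists i n, forall k, (n <= k)%N -> erosion U i.+1%:R^-1 (segment w 0 k)).
Proof.
move=> oU /totalP wl; split.
  move=> Ul; have /(gn_nbhs N)[e e0 eU] : nbhs (total w) U by exact: open_nbhs_nbhs.
  pose i := Num.truncn (e / 2)^-1.
  have ie : i.+1%:R^-1 < e / 2 by rewrite invf_plt ?posrE ?divr_gt0// truncnS_gt.
  exists i; have [|n nP] := wl (e / 2); first by rewrite divr_gt0.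
  exists n => k /nP h y yk; apply: eU.
  have := gnD N (y - segment w 0 k) (segment w 0 k - total w).
  by rewrite addrA subrK; have := lt_trans yk ie; move: h; lra.
move=> [i [n h]]; have [|m mP] := wl i.+1%:R^-1; first by [].
by apply: (h _ (leq_maxl n m)); rewrite gnBC; apply: mP; rewrite leq_maxr.
Qed.

Definition totalT (w : seqV) : borel V := total w.

Lemma measurable_total : measurable_fun [set: seqV] totalT.
Proof.
apply: (@measurability _ _ _ (borel V) _ _ (@open V)) => // _ [U oU <-].
rewrite setTI (_ : totalT @^-1` U =
  ([set w | summable w] `&` \bigcup_i \bigcup_n \bigcap_(k in [set k | (n <= k)%N])
     [set w : seqV | erosion U i.+1%:R^-1 (segment w 0 k)]) `|`
  (~` [set w | summable w] `&` [set w | U 0])).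
  apply: measurableU; apply: measurableI.
  - exact: measurable_summable.
  - apply: bigcupT_measurable => i; apply: bigcupT_measurable => n.
    apply: bigcap_measurableType => k _.
    exact: (measurable_segment_pre _ _ (measurable_erosion _ _)).
  - by apply: measurableC; exact: measurable_summable.
  - have [U0|nU0] := pselect (U 0).
      by rewrite (_ : [set w | _] = setT)//; apply/seteqP; split.
    by rewrite (_ : [set w | _] = set0)//; apply/seteqP; split.
apply/seteqP; split => w; rewrite /totalT/=.
  have [sw|nw] := pselect (summable w).
    move=> /(total_openE oU sw)[i [n h]]; left; split => //.
    by exists i => //; exists n.
  by rewrite total_not// => U0; right.
move=> [[sw [i _ [n _ h]]]|[nw U0]]; last by rewrite total_not.
by apply/(total_openE oU sw); exists i, n => k; exact: h.
Qed.

HB.instance Definition _ := isMeasurableFun.Build _ _ _ _ totalT measurable_total.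

Lemma segment_le w i j (b : nat -> R) : (forall k, (i <= k)%N -> N (w k) <= b k) ->
  N (segment w i j) <= \sum_(i <= k < j) b k.
Proof.
move=> h; have [ij|/ltnW ji] := leqP i j; last by rewrite /segment !big_geq// gn0.
rewrite -(subnKC ij); elim: (j - i)%N => [|k IH].
  by rewrite addn0 /segment !big_geq// gn0.
rewrite addnS /segment !big_nat_recr ?leq_addr//=.
by apply: le_trans (gnD _ _ _) _; apply: lerD => //; apply: h; exact: leq_addr.
Qed.

Lemma sum_geometric (C g : R) i j : 0 <= C -> 0 < g < 1 ->
  \sum_(i <= k < j) C * g ^+ k <= C / (1 - g) * g ^+ i.
Proof.
move=> C0 /andP[g0 g1].
have [ij|/ltnW ji] := leqP i j; last first.
  by rewrite big_geq// mulr_ge0// ?exprn_ge0 ?(ltW g0)// divr_ge0// subr_ge0 ltW.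
suff -> : \sum_(i <= k < j) C * g ^+ k = C / (1 - g) * (g ^+ i - g ^+ j).
  rewrite ler_wpM2l ?divr_ge0 ?subr_ge0 ?(ltW g1)//.
  by rewrite lerBlDr lerDl exprn_ge0 ?ltW.
have g10 : 1 - g != 0 by rewrite subr_eq0 eq_sym lt_eqF.
rewrite -(subnKC ij); elim: (j - i)%N => [|k IH].
  by rewrite addn0 big_geq// subrr mulr0.
rewrite addnS big_nat_recr ?leq_addr//= IH exprS.
by field.
Qed.

End RandomSeries.

(** * Infinite convolutions *)

Lemma geometric_small (R : realType) (c g e : R) : 0 < g < 1 -> 0 < e ->
  exists n, forall k, (n <= k)%N -> c * g ^+ k < e.
Proof.
move=> /andP[g0 g1] e0.
have : (fun n => c * g ^+ n) @ \oo --> c * 0.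
  by apply: cvgMr; apply: cvg_expr; rewrite gtr0_norm.
rewrite mulr0 => /cvgrPdist_lt/(_ e e0)[n _ nP]; exists n => k /nP/=.
by rewrite sub0r normrN; apply: le_lt_trans; exact: ler_norm.
Qed.

Section InfiniteConvolution.
Context (R : realType) (V : sctGroup) (N : group_norm R V).
Local Notation seqV := (seqT (borel V)).
Variables (sigma : nat -> law R V) (C g : R).
Hypothesis (C0 : 0 <= C) (g01 : 0 < g < 1).
Hypothesis sigmaP : forall n, tail N (sigma n) (C * g ^+ n) <= C * g ^+ n.

Let P n : probability seqV R := iprod (fun k => of_law (sigma (n + k))).
Let good M n : set seqV := [set w | forall j, (M <= j)%N -> N (w j) <= C * g ^+ (n + j)].
Let Cg := C / (1 - g).

Let g0 : 0 < g. Proof. by case/andP: g01. Qed.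

Let F M n j : set seqV := [set w | C * g ^+ (n + (M + j)) < N (w (M + j)%N)].

Let measurable_F M n j : measurable (F M n j).
Proof.
rewrite -[X in measurable X]setTI.
exact: (measurable_coord _ measurableT (measurable_gn_gt N (C * g ^+ (n + (M + j))))).
Qed.

Let goodE M n : good M n = ~` \bigcup_j F M n j.
Proof.
apply/seteqP; split => w /=.
  by move=> h [j _]; rewrite /F/= ltNge h// leq_addr.
move=> h j Mj; rewrite leNgt; apply/negP => hj; apply: h.
by exists (j - M)%N => //; rewrite /F/= subnKC.
Qed.

Let measurable_good M n : measurable (good M n).
Proof. by rewrite goodE; apply: measurableC; apply: bigcupT_measurable => j. Qed.

(** The union bound of the first Borel-Cantelli lemma, summed as a geometric
    series. *)
Lemma iprod_not_good M n : (P n (~` good M n) <= (Cg * g ^+ (n + M))%:E)%E.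
Proof.
rewrite goodE setCK.
apply: (le_trans (measure_sigma_subadditive _ _ _ (@subset_refl _ _))) => //.
  exact: bigcupT_measurable.
apply: lime_le; first exact: is_cvg_nneseries.
apply: nearW => k.
have -> : Cg * g ^+ (n + M) = C * g ^+ (n + M) / (1 - g) * g ^+ 0.
  by rewrite /Cg expr0; ring.
apply: le_trans (_ : _ <= (\sum_(0 <= j < k) (C * g ^+ (n + M)) * g ^+ j)%:E)%E _.
  rewrite -sumEFin; apply: lee_sum => j _.
  have E : P n (F M n j) = of_law (sigma (n + (M + j))) [set x | C * g ^+ (n + (M + j)) < N x] :=
    iprod_coord (M + j)%N (fun k => of_law (sigma (n + k)))
      (measurable_gn_gt N (C * g ^+ (n + (M + j)))).
  apply: (@le_trans _ _ (P n (F M n j))); rewrite ?lexx// E.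
  rewrite massE; last exact: measurable_gn_gt.
  by rewrite lee_fin -mulrA -exprD -addnA; exact: sigmaP.
by rewrite lee_fin sum_geometric// mulr_ge0// exprn_ge0// ltW.
Qed.

Lemma good_segment M n w i j : good M n w -> (M <= i)%N ->
  N (segment w i j) <= Cg * g ^+ (n + i).
Proof.
move=> gw Mi; apply: le_trans (@segment_le _ _ N w i j (fun k => C * g ^+ n * g ^+ k) _) _.
  by move=> k ik; rewrite -mulrA -exprD; apply: gw; exact: leq_trans ik.
have -> : Cg * g ^+ (n + i) = C * g ^+ n / (1 - g) * g ^+ i.
  by rewrite /Cg exprD; ring.
by apply: sum_geometric; rewrite // mulr_ge0// exprn_ge0// ltW.
Qed.

Lemma good_summable M n w : good M n w -> summable N w.
Proof.
move=> gw; apply/summableP => i.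
have [||m mP] := @geometric_small R (Cg * g ^+ n) g i.+1%:R^-1 => //.
exists (maxn M m) => k _; apply: le_lt_trans (good_segment k gw (leq_maxl _ _)) _.
by rewrite exprD mulrA; apply: mP; rewrite leq_maxr.
Qed.

Lemma iprod_not_summable n : P n (~` [set w | summable N w]) = 0%E.
Proof.
have mS := measurable_summable N.
apply/eqP; rewrite eq_le measure_ge0 andbT; apply/lee_addgt0Pr => e e0.
rewrite add0e; have [||M MP] := @geometric_small R (Cg * g ^+ n) g e => //.
apply: le_trans (_ : _ <= P n (~` good M n))%E _.
  apply: le_measure; rewrite ?inE; [exact: measurableC|exact: measurableC|].
  by move=> w ns gw; apply: ns; exact: good_summable gw.
apply: (le_trans (iprod_not_good M n)); rewrite lee_fin exprD mulrA ltW//.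
exact: MP.
Qed.

Lemma iprod_summableI n A : measurable A ->
  P n A = P n (A `&` [set w | summable N w]).
Proof.
move=> mA; have mS := measurable_summable N.
rewrite (measureDI (P n) mA mS) [X in (X + _)%E](_ : _ = 0%E) ?add0e//.
apply/eqP; rewrite eq_le measure_ge0 andbT -(iprod_not_summable n).
apply: le_measure; rewrite ?inE; [exact: measurableD|exact: measurableC|].
by move=> w [].
Qed.

Lemma good_total n w : good 0 n w -> N (total N w) <= Cg * g ^+ n.
Proof.
move=> gw; apply/ler_addgt0Pl => e e0.
have [m mP] := totalP (good_summable gw) e0.
have := mP m (leqnn m); have := @good_segment 0 n w 0 m gw (leqnn _); rewrite addn0.
by have := gn_sub N (total N w) (segment w 0 m); rewrite gnBC; lra.
Qed.

Definition tail_law n : law R V := to_law (distribution (P n) (totalT N)).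

(** Splitting off the first term of the series; the sum is only almost surely
    additive because of its default value on divergent series. *)
Lemma tail_lawS n : tail_law n = conv (sigma n) (tail_law n.+1).
Proof.
apply: lawP => B mB; rewrite convE// to_lawE//.
have mt : measurable (totalT N @^-1` B).
  by rewrite -[X in measurable X]setTI; exact: measurable_total.
transitivity (P n (totalT N @^-1` B)); first by [].
have -> := iprod_scons (fun k => of_law (sigma (n + k))) mt.
rewrite /= /product_measure1 addn0.
apply: eq_integral => x _ /=.
have -> : stail (fun k => of_law (sigma (n + k))) = fun k => of_law (sigma (n.+1 + k)).
  by apply/funext => k; rewrite /stail addSnnS.
have mx := measurable_shift_preimage x mB.
rewrite -/(P n.+1) -/(of_law (tail_law n.+1)) to_lawE// /distribution/pushforward/=.
have mt' : measurable (totalT N @^-1` (shift_preimage x B)).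
  by rewrite -[X in measurable X]setTI; exact: measurable_total.
have mxs : measurable (xsection (@scons _ (borel V) @^-1` (totalT N @^-1` B)) x).
  apply: measurable_xsection; rewrite -[X in measurable X]setTI.
  exact: measurable_scons.
rewrite [LHS]iprod_summableI// [RHS]iprod_summableI//; congr (P _ _).
apply/seteqP; split => w [/=].
  by rewrite /xsection/= in_setE/= => + sw; rewrite /totalT/shift_preimage/= -total_prepend.
by move=> + sw; rewrite /xsection/= in_setE/= /totalT/shift_preimage/= -total_prepend.
Qed.

Lemma tail_law_small n : tail N (tail_law n) (Cg * g ^+ n) <= Cg * g ^+ n.
Proof.
rewrite /tail -lee_fin -massE; last exact: measurable_gn_gt.
rewrite to_lawE; last exact: measurable_gn_gt.
apply: (@le_trans _ _ (P n (~` good 0 n))); last first.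
  by have := iprod_not_good 0 n; rewrite addn0.
change (P n (totalT N @^-1` [set x : borel V | (Cg * g ^+ n < N x)%R]) <= P n (~` good 0 n))%E.
apply: le_measure; rewrite ?inE.
- rewrite -[X in measurable X]setTI.
  by apply: (measurable_total N) => //; exact: measurable_gn_gt.
- exact: measurableC.
by move=> w /= h gw; move: h; rewrite ltNge good_total.
Qed.

End InfiniteConvolution.

(** [tau 0] is the infinite convolution of the [sigma n], and [tau n] its
    remainder after [n] factors. *)
Lemma infinite_convolution (R : realType) (V : sctGroup) (N : group_norm R V)
    (sigma : nat -> law R V) (C g : R) : 0 <= C -> 0 < g < 1 ->
  (forall n, tail N (sigma n) (C * g ^+ n) <= C * g ^+ n) ->
  exists tau : nat -> law R V, (forall n, tau n = conv (sigma n) (tau n.+1)) /\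
    forall n, tail N (tau n) (C / (1 - g) * g ^+ n) <= C / (1 - g) * g ^+ n.
Proof.
move=> C0 g01 sP; exists (tail_law N sigma); split.
  exact: tail_lawS sP.
exact: tail_law_small.
Qed.

(** * Geometric bounds and convolution powers *)

Lemma bernoulli (R : realType) (x : R) n : 0 <= x <= 1 -> 1 - n%:R * x <= (1 - x) ^+ n.
Proof.
move=> /andP[x0 x1]; elim: n => [|n IH]; first by rewrite mul0r subr0 expr0.
rewrite exprS; apply: (@le_trans _ _ ((1 - x) * (1 - n%:R * x))).
  rewrite -natr1; have : 0 <= n%:R * x * x by rewrite !mulr_ge0.
  by set y := n%:R; nra.
by rewrite ler_wpM2l// subr_ge0.
Qed.

(** A substitute for real roots that needs only Bernoulli's inequality. *)
Lemma root_lt1 (R : realType) (x : R) n : 0 <= x < 1 ->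
  exists2 q, 0 < q < 1 & x <= q ^+ n.
Proof.
move=> /andP[x0 x1]; pose y : R := (1 - x) / n.+2%:R.
have n2 : (2 : R) <= n.+2%:R by rewrite ler_nat.
have y0 : 0 < y by rewrite divr_gt0// subr_gt0.
have yE : y * n.+2%:R = 1 - x by rewrite divfK// pnatr_eq0.
have y1 : y < 1 by nra.
exists (1 - y); first by apply/andP; split; lra.
apply: le_trans (bernoulli n _); last by rewrite !ltW.
have : n%:R * y <= n.+2%:R * y.
  by apply: ler_wpM2r; [exact: ltW|rewrite ler_nat; lia].
by rewrite (mulrC n.+2%:R) yE; lra.
Qed.

Lemma expr_unbounded (R : realType) (u x : R) : 1 < u -> exists n, x <= u ^+ n.
Proof.
move=> u1; have u0 : 0 < u by rewrite (lt_trans _ u1).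
have [||n /(_ n (leqnn n)) nP] := @geometric_small R (Num.max x 1) u^-1 1 => //.
  by rewrite invr_gt0 u0 invf_lt1.
exists n; move: nP; rewrite exprVn ltr_pdivrMr ?exprn_gt0// mul1r => /ltW.
by apply: le_trans; rewrite le_max lexx.
Qed.

(** A polynomial factor is absorbed by a slightly larger ratio: bound [(n + 1)
    y ^ n] by a geometric series, where [y ^ m] is at least the ratio of the
    two geometric sequences. *)
Lemma poly_geometric (R : realType) (h : R) m : 0 < h < 1 ->
  exists C g, [/\ 0 < C, 0 < g < 1, h <= g &
    forall n, n.+1%:R ^+ m * h ^+ n <= C * g ^+ n].
Proof.
move=> /andP[h0 h1]; pose g := (1 + h) / 2.
have hg : h < g by rewrite /g; lra.
have g1 : g < 1 by rewrite /g; lra.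
have g0 : 0 < g by lra.
have z01 : 0 <= h / g < 1 by rewrite divr_ge0 ?ltW//= ltr_pdivrMr// mul1r.
have [y /andP[y0 y1] zy] := @root_lt1 R (h / g) m z01.
exists ((1 - y)^-1 ^+ m), g; split; rewrite ?g0 ?ltW//.
  by rewrite exprn_gt0// invr_gt0 subr_gt0.
move=> n; have -> : h ^+ n = (h / g) ^+ n * g ^+ n.
  by rewrite -exprMn divfK// gt_eqF.
rewrite mulrA ler_wpM2r ?exprn_ge0 ?(ltW g0)//.
apply: (@le_trans _ _ ((n.+1%:R * y ^+ n) ^+ m)).
  rewrite [leRHS]exprMn; apply: ler_wpM2l; rewrite ?exprn_ge0// -exprM mulnC exprM.
  by rewrite lerXn2r ?nnegrE ?exprn_ge0 ?(ltW y0)//; case/andP: z01.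
rewrite lerXn2r ?nnegrE ?mulr_ge0 ?exprn_ge0 ?invr_ge0 ?subr_ge0 ?(ltW y0) ?(ltW y1)//.
have := @sum_geometric R 1 y 0 n.+1 ler01; rewrite y0 y1 expr0 mulr1 mul1r => /(_ isT).
apply: le_trans; rewrite mulrC.
have -> : y ^+ n * n.+1%:R = \sum_(0 <= k < n.+1) y ^+ n.
  by rewrite sumr_const_nat subn0 mulr_natr.
rewrite !big_nat; apply: ler_sum => k /andP[_ kn]; rewrite mul1r.
by rewrite ler_wiXn2l// ltW.
Qed.

(** Decay by a factor [b] under each multiplication by [A] is polynomial decay
    in [x], hence geometric decay along the powers of any [u > 1]. *)
Lemma geometric_decay (R : realType) (t : R -> R) (A a b : R) :
  (forall x, 0 <= t x <= 1) -> (forall x y, x <= y -> t y <= t x) ->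
  0 < a -> 0 <= b < 1 -> (forall x, a <= x -> t (A * x) <= b * t x) ->
  forall u, 1 < u -> exists C q, [/\ 0 < C, 0 < q < 1 & forall n, t (u ^+ n) <= C * q ^+ n].
Proof.
move=> t01 tle a0 b01 tA u u1.
have u0 : 0 < u by rewrite (lt_trans _ u1).
have [k kA] := expr_unbounded A u1; have [l la] := expr_unbounded a u1.
have [q /andP[q0 q1] qb] := @root_lt1 R b k.+1 b01.
exists (q ^+ (l + k.+1))^-1, q; split; rewrite ?invr_gt0 ?exprn_gt0// ?q0//.
have kA1 : A <= u ^+ k.+1.
  by apply: (le_trans kA); rewrite ler_weXn2l// ltW.
(* u ^ k.+1 is at least A, and u ^ l is at least a *)
elim/ltn_ind => n IH; have [nl|ln] := ltnP n (l + k.+1).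
  apply: (@le_trans _ _ 1); first by case/andP: (t01 (u ^+ n)).
  rewrite mulrC ler_pdivlMr ?exprn_gt0// mul1r.
  by rewrite ler_wiXn2l// ?(ltW q0) ?(ltW q1)// ltnW.
have nk : (n - k.+1 < n)%N by lia.
have h1 : a <= u ^+ (n - k.+1).
  by apply: (le_trans la); rewrite ler_weXn2l ?(ltW u1)//; lia.
have h2 : t (u ^+ n) <= t (A * u ^+ (n - k.+1)).
  apply: tle; have -> : u ^+ n = u ^+ k.+1 * u ^+ (n - k.+1).
    by rewrite -exprD subnKC//; lia.
  by rewrite ler_wpM2r// exprn_ge0// ltW.
apply: (le_trans h2); apply: (le_trans (tA _ h1)).
have -> : q ^+ n = q ^+ k.+1 * q ^+ (n - k.+1) by rewrite -exprD subnKC//; lia.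
rewrite mulrCA; apply: ler_pM => //; first by case/andP: b01.
- by case/andP: (t01 (u ^+ (n - k.+1))).
- exact: IH.
Qed.

Section Peel.
Context (R : realType) (V : sctGroup).
Local Notation conv := (@conv R V).
Local Notation law1 := (law1 R V).

Definition conv_power (l : law R V) n := \big[conv/law1]_(i < n) l.

Lemma big_nseq_conv_power (I : Type) (x : I) (F : I -> law R V) n :
  \big[conv/law1]_(y <- nseq n x) F y = conv_power (F x) n.
Proof. by rewrite /conv_power big_nseq big_const_ord. Qed.

Lemma conv_powerD l m n : conv_power l (m + n) = conv (conv_power l m) (conv_power l n).
Proof. by rewrite /conv_power big_split_ord. Qed.

Lemma conv_power_conv l l' n : conv_power (conv l l') n = conv (conv_power l n) (conv_power l' n).
Proof. by rewrite /conv_power big_split. Qed.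

Lemma conv_power_big (I : Type) (s : seq I) (F : I -> law R V) n :
  conv_power (\big[conv/law1]_(i <- s) F i) n = \big[conv/law1]_(i <- s) conv_power (F i) n.
Proof. by rewrite /conv_power exchange_big. Qed.

Lemma conv_powerM l m n : conv_power l (m * n) = conv_power (conv_power l m) n.
Proof.
elim: n => [|n IH]; first by rewrite muln0 /conv_power !big_ord0.
by rewrite mulnS conv_powerD IH [RHS]/conv_power big_ord_recl.
Qed.

Variables (I : eqType) (F : I -> law R V) (k : nat).

Definition quotients (s : seq I) := flatten [seq nseq (count_mem a s %/ k) a | a <- undup s].
Definition remainders (s : seq I) := flatten [seq nseq (count_mem a s %% k) a | a <- undup s].

Lemma big_flatten_nseq (s : seq I) (c : I -> nat) :
  \big[conv/law1]_(x <- flatten [seq nseq (c a) a | a <- s]) F x =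
  \big[conv/law1]_(a <- s) conv_power (F a) (c a).
Proof. by rewrite big_flatten big_map; apply: eq_bigr => a _; exact: big_nseq_conv_power. Qed.

(** Equal factors are grouped by [k]; the multiplicity of each is divided by
    [k] with remainder. *)
Lemma peel s : \big[conv/law1]_(x <- s) F x =
  conv (conv_power (\big[conv/law1]_(x <- quotients s) F x) k)
       (\big[conv/law1]_(x <- remainders s) F x).
Proof.
rewrite -(perm_big _ (perm_count_undup s))/= !big_flatten_nseq conv_power_big -big_split/=.
by apply: eq_bigr => a _; rewrite -conv_powerM -conv_powerD -divn_eq.
Qed.

Lemma mem_quotients s : {subset quotients s <= s}.
Proof.
by move=> x /flattenP[_ /mapP[a +] ->]; rewrite mem_undup mem_nseq => + /andP[_ /eqP ->].
Qed.

Lemma mem_remainders s : {subset remainders s <= s}.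
Proof.
by move=> x /flattenP[_ /mapP[a +] ->]; rewrite mem_undup mem_nseq => + /andP[_ /eqP ->].
Qed.

Lemma size_flatten_nseq (s : seq I) (c : I -> nat) :
  size (flatten [seq nseq (c a) a | a <- s]) = (\sum_(a <- s) c a)%N.
Proof.
rewrite size_flatten /shape -map_comp sumnE big_map.
by apply: eq_bigr => a _; rewrite /= size_nseq.
Qed.

Lemma size_quotients s : (size (quotients s) <= size s)%N.
Proof.
rewrite -[X in (_ <= X)%N](perm_size (perm_count_undup s)) !size_flatten_nseq.
by apply: leq_sum => a _; exact: leq_div.
Qed.

Lemma size_remainders s : (0 < k)%N -> (size (remainders s) <= k * size (undup s))%N.
Proof.
move=> k0; rewrite size_flatten_nseq -(count_predT (undup s)) -iter_addn_0 -big_const_seq.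
by apply: leq_sum => a _; apply/ltnW; rewrite ltn_mod.
Qed.

End Peel.

(** * Words in the contractions and extraction of roots *)

Section Words.
Context (R : realType) (V : sctGroup) (m : nat) (T : 'I_m -> V -> V).
Local Notation conv := (@conv R V).
Local Notation law1 := (law1 R V).

Definition act (w : seq 'I_m) (x : V) : V := foldr T x w.

Hypothesis mT : forall i, measurable_fun [set: borel V] (T i : borel V -> borel V).
Hypothesis TD : forall i, {morph T i : x y / x + y}.
Hypothesis TC : forall i j x, T i (T j x) = T j (T i x).

Lemma act_cat w1 w2 x : act (w1 ++ w2) x = act w1 (act w2 x).
Proof. exact: foldr_cat. Qed.

Lemma act_T w i x : act w (T i x) = T i (act w x).
Proof. by elim: w => //= j w ->; rewrite TC. Qed.

(** The maps commute. *)
Lemma act_perm w w' x : perm_eq w w' -> act w x = act w' x.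
Proof.
elim: w w' => [|i w IH] w' pw.
  by move/perm_size/esym/size0nil: pw => ->.
have : i \in w' by rewrite -(perm_mem pw) mem_head.
move=> /path.splitPr pw'; case: pw' pw => w1 w2.
rewrite perm_sym -[i :: w2]cat1s perm_catCA perm_cons perm_sym => /IH /= ->.
by rewrite !act_cat/= act_T.
Qed.

Lemma measurable_act w : measurable_fun [set: borel V] (act w : borel V -> borel V).
Proof.
elim: w => [|i w IH]; first exact: measurable_id.
exact: (measurableT_comp (mT i) IH).
Qed.

Lemma actD w : {morph act w : x y / x + y}.
Proof. by elim: w => [//|i w IH] x y; rewrite /= IH TD. Qed.

Variable mu : law R V.
Hypothesis muE : mu = \big[conv/law1]_(i < m) image_law (T i) mu.

Definition word_law w := image_law (act w) mu.
Definition words_law (s : seq (seq 'I_m)) := \big[conv/law1]_(w <- s) word_law w.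

Lemma word_law_nil : word_law [::] = mu.
Proof. by apply: lawP => B mB; rewrite image_lawE//; exact: (measurable_act [::]). Qed.

(** The equation for [mu] transported by the word [w]. *)
Lemma word_law_cons w : word_law w = \big[conv/law1]_(i < m) word_law (i :: w).
Proof.
rewrite {1}/word_law {1}muE image_law_big; [|exact: measurable_act|exact: actD].
apply: eq_bigr => i _; apply: lawP => B mB.
have ma := measurable_act w.
rewrite !image_lawE//; [|exact: (measurable_act (i :: w))|exact: measurable_preimage_fun].
by congr (of_law _ _); apply/funext => x /=; rewrite /preimage/= act_T.
Qed.

Lemma word_law_perm w w' : perm_eq w w' -> word_law w = word_law w'.
Proof. by move=> pw; congr image_law; apply/funext => x; exact: act_perm. Qed.

(** Sorted words represent words up to permutation. *)
Definition sort_word (w : seq 'I_m) := sort (fun i j : 'I_m => (i <= j)%N) w.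

Definition expand (s : seq (seq 'I_m)) : seq (seq 'I_m) :=
  [seq sort_word (i :: w) | w <- s, i <- enum 'I_m].

Lemma words_law_expand s : words_law s = words_law (expand s).
Proof.
rewrite /words_law /expand big_allpairs_dep; apply: eq_bigr => w _.
rewrite word_law_cons big_enum/=; apply: eq_bigr => i _.
by apply: word_law_perm; rewrite perm_sym perm_sort.
Qed.

Lemma size_expand s : size (expand s) = (m * size s)%N.
Proof. by rewrite size_allpairs size_enum_ord mulnC. Qed.

Definition sorted_word n (w : seq 'I_m) := (size w == n) && (sort_word w == w).

Lemma sorted_wordP n w w' : sorted_word n w -> sorted_word n w' ->
  (forall i, count_mem i w = count_mem i w') -> w = w'.
Proof.
move=> /andP[_ /eqP <-] /andP[_ /eqP <-] cw.
have pw : perm_eq w w'.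
  apply/allP => i _ /=; apply/eqP.
  by have := cw i; rewrite !(permP (permEl (perm_sort _ _))).
apply/perm_sortP => //.
- by move=> i j; exact: leq_total.
- by move=> i j k; exact: leq_trans.
- by move=> i j /anti_leq/val_inj.
Qed.

Lemma expand_sorted n s : {in s, forall w, sorted_word n w} ->
  {in expand s, forall w, sorted_word n.+1 w}.
Proof.
move=> sn _ /allpairsPdep[w [i [ws _ ->]]]; have /andP[/eqP wn _] := sn w ws.
rewrite /sorted_word size_sort/= wn eqxx/=; apply/eqP.
rewrite /sort_word sorted_sort//; first by move=> a b c; exact: leq_trans.
by apply: sort_sorted => a b; exact: leq_total.
Qed.

(** The letter counts of a word of length [n] are [m] numbers at most [n]:
    there are polynomially many kinds of words, against exponentially many
    words. *)
Lemma size_undup_sorted n s : {in s, forall w, sorted_word n w} ->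
  (size (undup s) <= n.+1 ^ m)%N.
Proof.
move=> sn; pose key (w : seq 'I_m) : {ffun 'I_m -> 'I_n.+1} := [ffun i => inord (count_mem i w)].
have cw i w : w \in s -> (count_mem i w < n.+1)%N.
  by move=> /sn/andP[/eqP wn _]; rewrite ltnS -wn count_size.
have inj : {in undup s &, injective key}.
  move=> w w'; rewrite !mem_undup => ws ws' /ffunP E.
  apply: (sorted_wordP (sn _ ws) (sn _ ws')) => i.
  by have := E i; rewrite !ffunE => /(congr1 val)/=; rewrite !inordK ?cw.
rewrite -(size_map key); have /card_uniqP <- : uniq (map key (undup s)).
  by rewrite map_inj_in_uniq// undup_uniq.
by apply: (leq_trans (max_card _)); rewrite card_ffun !card_ord.
Qed.

Variable k : nat.
Hypothesis k0 : (0 < k)%N.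

(** At each length, the words that could not be grouped by [k]; their
    one-letter extensions are grouped again at the next length. *)
Fixpoint leftovers n : seq (seq 'I_m) :=
  if n is n'.+1 then remainders k (expand (leftovers n')) else [:: [::]].

(** One word of each group of [k] equal ones. *)
Definition extracts n : seq (seq 'I_m) := quotients k (expand (leftovers n)).

Lemma leftovers_sorted n : {in leftovers n, forall w, sorted_word n w}.
Proof.
elim: n => [|n IH] w; first by rewrite mem_seq1 => /eqP ->.
by move=> /mem_remainders; exact: expand_sorted.
Qed.

Lemma extracts_sorted n : {in extracts n, forall w, sorted_word n.+1 w}.
Proof. by move=> w /mem_quotients; apply: expand_sorted; exact: leftovers_sorted. Qed.

Lemma size_leftovers n : (size (leftovers n) <= k * n.+1 ^ m)%N.
Proof.
case: n => [|n]; first by rewrite exp1n muln1.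
apply: (leq_trans (size_remainders _ k0)); rewrite leq_mul2l; apply/orP; right.
have := size_undup_sorted (expand_sorted (@leftovers_sorted n)) => /leq_trans; exact.
Qed.

Lemma size_extracts n : (size (extracts n) <= m * (k * n.+1 ^ m))%N.
Proof.
apply: (leq_trans (size_quotients _ _)); rewrite size_expand leq_mul2l.
by rewrite size_leftovers orbT.
Qed.

Lemma words_law_leftovers n : words_law (leftovers n) =
  conv (conv_power (words_law (extracts n)) k) (words_law (leftovers n.+1)).
Proof. by rewrite words_law_expand; exact: peel. Qed.

(** The approximate [k]-th root: for large [n] the last factor is close to the
    unit mass at 0. *)
Lemma mu_leftovers n : mu =
  conv (conv_power (\big[conv/law1]_(j < n) words_law (extracts j)) k)
    (words_law (leftovers n)).
Proof.
elim: n => [|n IH].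
  by rewrite big_ord0 /words_law big_seq1 word_law_nil /conv_power big1// Monoid.mul1m.
by rewrite {1}IH words_law_leftovers big_ord_recr/= conv_power_conv Monoid.mulmA.
Qed.

Variable (N : group_norm R V).
Variables (B r : R).
Hypothesis B0 : 0 < B.
Hypothesis r01 : 0 < r < 1.
Hypothesis act_le : forall w x, N (act w x) <= B * r ^+ size w * N x.

Lemma tail_word_law w t : 0 <= t -> tail N (word_law w) (B * r ^+ size w * t) <= tail N mu t.
Proof.
move=> t0; have [r0 r1] := andP r01.
have ma := measurable_act w.
have mg := @measurable_gn_gt _ _ N.
rewrite /tail /mass image_lawE// -/(mass _ _) -/(mass _ _).
apply: mass_le => //; first exact: measurable_preimage_fun.
move=> x /=; have := act_le w x.
have : 0 < B * r ^+ size w by rewrite mulr_gt0// exprn_gt0.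
move=> b0 h xt; have := lt_le_trans xt h; rewrite ltr_pM2l//.
Qed.

Variables (C q : R) (u : R).
Hypothesis C0 : 0 < C.
Hypothesis q01 : 0 < q < 1.
Hypothesis u1 : 1 < u.
Hypothesis ur : u * r < 1.
Hypothesis tail_mu : forall n, tail N mu (u ^+ n) <= C * q ^+ n.

(** Polynomially many factors, each of geometrically small size outside an
    event of geometrically small probability. The scale [u ^ n] for the tail
    of [mu] is chosen so that [r ^ n * u ^ n] is still small. *)
Lemma tail_words_law_geometric : exists X g, [/\ 0 <= X, 0 < g < 1 &
  forall n s, {in s, forall w, sorted_word n w} \/ {in s, forall w, sorted_word n.+1 w} ->
    (size s <= m * (k * n.+1 ^ m) + k * n.+1 ^ m)%N ->
    tail N (words_law s) (X * g ^+ n) <= X * g ^+ n].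
Proof.
have [r0 r1] := andP r01; have [q0 q1] := andP q01.
pose h := Num.max (u * r) q.
have u0 : 0 < u by rewrite (lt_trans _ u1).
have ur0 : 0 < u * r by rewrite mulr_gt0.
have h01 : 0 < h < 1 by rewrite /h lt_max ur0/= gt_max ur q1.
have [D [g [D0 g01 hg Dg]]] := poly_geometric m h01.
pose c : R := (m * k + k)%:R; pose X := c * (B + C) * D.
have c0 : 0 <= c by rewrite ler0n.
have h0 : 0 < h by case/andP: h01.
have X0 : 0 <= X by rewrite !mulr_ge0 ?addr_ge0 ?(ltW B0) ?(ltW C0) ?(ltW D0).
exists X, g; split => // n s sn ssz.
have sz (e : R) : 0 <= e -> e <= (B + C) * h ^+ n -> (size s)%:R * e <= X * g ^+ n.
  move=> e0 eh; apply: (@le_trans _ _ (c * n.+1%:R ^+ m * e)).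
    rewrite ler_wpM2r// /c -natrX -natrM ler_nat; apply: (leq_trans ssz).
    by rewrite mulnDl mulnA.
  apply: (@le_trans _ _ (c * n.+1%:R ^+ m * ((B + C) * h ^+ n))).
    by rewrite ler_wpM2l// mulr_ge0// exprn_ge0.
  have -> : c * n.+1%:R ^+ m * ((B + C) * h ^+ n) = c * (B + C) * (n.+1%:R ^+ m * h ^+ n) by ring.
  rewrite /X -!mulrA; apply: ler_wpM2l => //; apply: ler_wpM2l; last exact: Dg.
  by rewrite addr_ge0// ltW.
have e10 : 0 <= B * r ^+ n * u ^+ n by rewrite !mulr_ge0 ?exprn_ge0 ?ltW.
have e1 : B * r ^+ n * u ^+ n <= (B + C) * h ^+ n.
  rewrite -mulrA -exprMn mulrDl -[X in X <= _]addr0 lerD//.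
    rewrite ler_wpM2l ?(ltW B0)// lerXn2r ?nnegrE ?mulr_ge0 ?(ltW h0) ?(ltW r0) ?(ltW u0)//.
    by rewrite mulrC /h le_max lexx.
  by rewrite mulr_ge0 ?exprn_ge0 ?ltW.
have e2 : C * q ^+ n <= (B + C) * h ^+ n.
  rewrite mulrDl -[X in X <= _]add0r lerD//; first by rewrite mulr_ge0 ?exprn_ge0 ?ltW.
  rewrite ler_wpM2l ?(ltW C0)// lerXn2r ?nnegrE ?(ltW h0) ?(ltW q0)//.
  by rewrite /h le_max lexx orbT.
apply: (le_trans (tail_le N _ (sz _ e10 e1))).
apply: (@le_trans _ _ ((size s)%:R * (C * q ^+ n))); last first.
  by apply: sz => //; rewrite mulr_ge0 ?exprn_ge0 ?ltW.
apply: tail_big_le => // w ws; apply: le_trans (tail_mu n).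
apply: le_trans (tail_word_law w (exprn_ge0 n (ltW u0))).
apply: tail_le; rewrite ler_wpM2r ?exprn_ge0 ?(ltW u0)// ler_wpM2l ?(ltW B0)//.
by rewrite ler_wiXn2l ?(ltW r0) ?(ltW r1)//; case: sn => /(_ w ws)/andP[/eqP -> _].
Qed.

(** With [nu] the infinite convolution of the extracted laws and [tau n] its
    remainders, [nu ^ k * rho_n = mu * (tau n) ^ k] for all [n], and
    [limit_unique] applies. *)
Lemma root_exists : exists nu, mu = conv_power nu k.
Proof.
have [X [g [X0 g01 Xg]]] := tail_words_law_geometric.
have [tau [tauE tauP]] : exists tau : nat -> law R V,
    (forall n, tau n = conv (words_law (extracts n)) (tau n.+1)) /\
    forall n, tail N (tau n) (X / (1 - g) * g ^+ n) <= X / (1 - g) * g ^+ n.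
  apply: infinite_convolution => // n; apply: Xg; first by right; exact: extracts_sorted.
  by apply: (leq_trans (size_extracts n)); exact: leq_addr.
have [g0 g1] := andP g01.
pose Y := X / (1 - g).
have Y0 : 0 <= Y by rewrite divr_ge0// subr_ge0 ltW.
have tau0 n : tau 0%N = conv (\big[conv/law1]_(j < n) words_law (extracts j)) (tau n).
  elim: n => [|n IH]; first by rewrite big_ord0 Monoid.mul1m.
  by rewrite big_ord_recr/= -Monoid.mulmA/= -tauE.
exists (tau 0%N); apply/esym.
apply: (@limit_unique _ _ N _ _ (fun n => words_law (leftovers n)) (fun n => conv_power (tau n) k)).
  move=> n; rewrite {1}(tau0 n) conv_power_conv [in RHS](mu_leftovers n).
  by rewrite -!Monoid.mulmA/=; congr conv; exact: Monoid.mulmC.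
move=> e d e0 d0.
pose f := Num.min e d; have f0 : 0 < f by rewrite /f lt_min e0.
have [||n1 n1P] := @geometric_small R X g f => //.
have [||n2 n2P] := @geometric_small R (k%:R * Y) g f => //.
pose n := maxn n1 n2; exists n.
have h1 : X * g ^+ n < f by apply: n1P; rewrite leq_maxl.
have h2 : k%:R * Y * g ^+ n < f by apply: n2P; rewrite leq_maxr.
move: h1 h2; rewrite !lt_min => /andP[h1e h1d] /andP[h2e h2d]; split.
  apply: le_lt_trans h1d; apply: le_trans (tail_le N _ (ltW h1e)) _.
  apply: Xg; first by left; exact: leftovers_sorted.
  by apply: (leq_trans (size_leftovers n)); exact: leq_addl.
apply: le_lt_trans h2d; apply: le_trans (tail_le N _ (ltW h2e)) _.
rewrite -(big_nseq_conv_power tt (fun=> tau n)) -(mulrA k%:R Y).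
rewrite -[X in X%:R](size_nseq k tt); apply: tail_big_le => [|_ _].
  by rewrite mulr_ge0// exprn_ge0// ltW.
exact: tauP.
Qed.

End Words.

(** * Decay of the tails *)

Section TailDecay.
Context (R : realType) (V : sctGroup) (N : group_norm R V).
Local Notation conv := (@conv R V).
Local Notation law1 := (law1 R V).

Lemma tail_image_ge (f : V -> V) (mu : law R V) c e :
  measurable_fun [set: borel V] (f : borel V -> borel V) -> 0 < c ->
  (forall x, N x <= c * N (f x)) -> tail N mu (c * e) <= tail N (image_law f mu) e.
Proof.
move=> mf c0 fc; rewrite /tail [X in _ <= X]/mass image_lawE//; last exact: measurable_gn_gt.
rewrite -/(mass _ _); apply: mass_le.
- exact: measurable_gn_gt.
- by apply: measurable_preimage_fun => //; exact: measurable_gn_gt.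
- by move=> x /= h; have := lt_le_trans h (fc x); rewrite ltr_pM2l.
Qed.

(** By [tail_conv_ge] the tail of [mu] at [x] is almost the sum of the tails
    of [l1] and [l2] near [x], each of which is at least the tail of [mu] at
    [3 * c * x]. *)
Lemma tail_doubling (mu l1 l2 l3 : law R V) c : 0 < c ->
  mu = conv l1 (conv l2 l3) ->
  (forall e, tail N mu (c * e) <= tail N l1 e) ->
  (forall e, tail N mu (c * e) <= tail N l2 e) ->
  exists2 a, 0 < a & forall x, a <= x -> tail N mu (3 * c * x) <= 2 / 3 * tail N mu x.
Proof.
move=> c0 muE h1 h2.
(* with tails at most 1/10, the two events weigh 9/10 and (9/10)^2,
   and 9/10 + 81/100 is at least 3/2 *)
have d0 : 0 < 10^-1 :> R by rewrite invr_gt0.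
have [a1 a10 t1] := tail_small N l1 d0.
have [a2 a20 t2] := tail_small N (conv l2 l3) d0.
have [a3 a30 t3] := tail_small N l3 d0.
pose a := a1 + a2 + a3.
have a0 : 0 < a by rewrite !addr_gt0.
exists a => // x ax; have x0 : 0 <= x by rewrite (le_trans _ ax) ?ltW.
have le1 l e e' d : tail N l e < d -> e <= e' -> tail N l e' <= d.
  by move=> ld ee; rewrite ltW// (le_lt_trans _ ld)// tail_le.
have T1 := le1 l1 a1 a _ t1; have T2 := le1 _ a2 a _ t2; have T3 := le1 l3 a3 a _ t3.
have {}T1 : tail N l1 a <= 10^-1 by apply: T1; rewrite /a; lra.
have {}T2 : tail N (conv l2 l3) a <= 10^-1 by apply: T2; rewrite /a; lra.
have {}T3 : tail N l3 a <= 10^-1 by apply: T3; rewrite /a; lra.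
have G1 := @tail_conv_ge _ _ N l1 (conv l2 l3) x a x0.
have G2 : tail N l2 (x + a + a) * (1 - tail N l3 a) <= tail N (conv l2 l3) (x + a).
  apply: le_trans (@tail_conv_ge _ _ N l2 l3 (x + a) a _); last by rewrite addr_ge0// ltW.
  rewrite lerDl mulr_ge0 ?tail_ge0// subr_ge0 tail_le1//.
have cx : c * (x + a + a) <= 3 * c * x.
  have -> : 3 * c * x = c * (3 * x) by ring.
  by rewrite ler_pM2l//; lra.
have H1 : tail N mu (3 * c * x) <= tail N l1 (x + a).
  apply: le_trans (h1 _); apply: tail_le; apply: le_trans cx.
  by rewrite ler_pM2l// lerDl ltW.
have H2 : tail N mu (3 * c * x) <= tail N l2 (x + a + a).
  by apply: le_trans (h2 _); apply: tail_le.
rewrite -muE in G1; move: G1 G2 H1 H2 T1 T2 T3.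
have := tail_ge0 N l1 (x + a); have := tail_ge0 N l2 (x + a + a).
have := tail_ge0 N mu (3 * c * x).
have := tail_ge0 N l1 a; have := tail_ge0 N (conv l2 l3) a; have := tail_ge0 N l3 a.
set y := tail N mu (3 * c * x); set z := tail N mu x.
set p := tail N l1 (x + a); set q := tail N l2 _; set s := tail N (conv l2 l3) (x + a).
set e1 := tail N l1 a; set e2 := tail N (conv l2 l3) a; set e3 := tail N l3 a.
move=> e30 e20 e10 y0 q0 p0 G1 G2 H1 H2 T1 T2 T3.
have K1 : 9 / 10 * y <= p * (1 - e2) by nra.
have K2 : 9 / 10 * y <= s by nra.
have K3 : 9 / 10 * (9 / 10 * y) <= (1 - e1) * s by nra.
lra.
Qed.

Section Decay.
Variables (m : nat) (T : 'I_m -> V -> V).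
Hypothesis mT : forall i, measurable_fun [set: borel V] (T i : borel V -> borel V).
Hypothesis TD : forall i, {morph T i : x y / x + y}.
Hypothesis TC : forall i j x, T i (T j x) = T j (T i x).
Variable mu : law R V.
Hypothesis muE : mu = \big[conv/law1]_(i < m) image_law (T i) mu.
Variables (B r c : R).
Hypothesis B0 : 0 < B.
Hypothesis r01 : 0 < r < 1.
Hypothesis act_le : forall w x, N (act T w x) <= B * r ^+ size w * N x.
Hypothesis c0 : 0 < c.
Hypothesis T_ge : forall i x, N x <= c * N (T i x).
Hypothesis m0 : (0 < m)%N.

(** For a single map, [mu] is its own image under all iterates, so its tail
    vanishes; otherwise [tail_doubling] applies to the first two maps. *)
Lemma tail_decay u : 1 < u ->
  exists C q, [/\ 0 < C, 0 < q < 1 & forall n, tail N mu (u ^+ n) <= C * q ^+ n].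
Proof.
move=> u1; have [m1|m2] := leqP m 1.
- exists 1, 2^-1; split => //; first by apply/andP; split; lra.
  move=> n; have un : 0 < u ^+ n by rewrite exprn_gt0// (lt_trans _ u1).
  suff -> : tail N mu (u ^+ n) = 0 by rewrite mul1r exprn_ge0.
  apply/eqP; rewrite eq_le tail_ge0 andbT; apply/ler_addgt0Pl => e e0; rewrite addr0.
  have [a a0 ta] := tail_small N mu e0.
  have [||k /(_ k (leqnn k)) kP] := @geometric_small R (B * a) r (u ^+ n) => //.
  pose i0 := Ordinal m0; pose w := nseq k i0.
  have wE : word_law T mu w = mu.
    rewrite /w; elim: (k) => [|j IH]; first exact: word_law_nil.
    rewrite -[RHS]IH [RHS](word_law_cons mT TD TC muE) (big_pred1 i0)// => i.
    by rewrite /= -val_eqE/= -leqn0 -ltnS (leq_trans (ltn_ord i)).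
  apply/ltW/(le_lt_trans _ ta); rewrite -{1}wE.
  have := tail_word_law mT mu B0 r01 act_le w (ltW a0).
  apply: le_trans; apply: tail_le; rewrite size_nseq mulrAC.
  exact: ltW.
- have [a a0 aP] : exists2 a, 0 < a &
      forall x, a <= x -> tail N mu (3 * c * x) <= 2 / 3 * tail N mu x.
    case: m m2 T muE mT T_ge => [//|[//|m']] _ T' muE' mT' T_ge'.
    rewrite !big_ord_recl/= in muE'.
    apply: (tail_doubling c0 muE') => e; exact: tail_image_ge.
  apply: (@geometric_decay R (tail N mu) (3 * c) a (2 / 3)) => //.
  + by move=> x; rewrite tail_ge0 tail_le1.
  + by move=> x y; exact: tail_le.
  + by apply/andP; split; lra.
Qed.

Lemma law_root k : (0 < k)%N -> exists nu, mu = conv_power nu k.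
Proof.
move=> k0; have [r0 r1] := andP r01.
(* u * r is halfway between r and 1 *)
pose u := (1 + r) / (2 * r).
have r20 : 0 < 2 * r by rewrite mulr_gt0.
have u1 : 1 < u by rewrite /u ltr_pdivlMr// mul1r; lra.
have ur : u * r < 1.
  have -> : u * r = (1 + r) / 2 by rewrite /u; field; rewrite gt_eqF.
  lra.
have [C [q [C0 q01 Cq]]] := tail_decay u1.
exact: (root_exists mT TD TC muE k0 B0 r01 act_le C0 q01 u1 ur Cq).
Qed.

End Decay.
End TailDecay.

(** * Translation invariance *)

Section Invariance.
Context (R : realType) (V : sctGroup) (N : group_norm R V).
Local Notation conv := (@conv R V).
Local Notation law1 := (law1 R V).
Implicit Types l : law R V.

Definition invariant_by (h : V) l := forall B, measurable B -> l (shift_preimage h B) = l B.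

Lemma shift_preimageD (x y : V) (B : set (borel V)) :
  shift_preimage x (shift_preimage y B) = shift_preimage (y + x) B.
Proof. by apply/seteqP; split => z; rewrite /shift_preimage/= addrA. Qed.

Lemma invariant_conv h l1 l2 : invariant_by h l1 -> invariant_by h (conv l1 l2).
Proof.
move=> inv B mB; have mhB := measurable_shift_preimage h mB.
rewrite convC !convE//; apply: eq_integral => x _.
by rewrite shift_preimageD addrC -shift_preimageD inv//; exact: measurable_shift_preimage.
Qed.

Lemma invariant_mulrn h l n : invariant_by h l -> invariant_by (h *+ n) l.
Proof.
move=> inv; elim: n => [|n IH] B mB.
  by congr (of_law _ _); apply/seteqP; split => z; rewrite /shift_preimage/= mulr0n add0r.
by rewrite mulrSr -shift_preimageD inv ?IH//; exact: measurable_shift_preimage.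
Qed.

(** A set of mass more than one half would have a disjoint translate of the
    same mass. *)
Lemma not_invariant_unbounded h l : (forall x : R, exists n, x < N (h *+ n)) ->
  ~ invariant_by h l.
Proof.
move=> unb inv; have [a a0 ta] := @tail_small _ _ N l 4^-1 ltac:(by rewrite invr_gt0).
have [n nP] := unb (a + a).
pose A : set (borel V) := [set x | N x <= a].
have mA : measurable A by exact: measurable_gn_le.
have mB := measurable_shift_preimage (h *+ n) mA.
have : mass l (shift_preimage (h *+ n) A) <= mass l (~` A).
  apply: mass_le => //; first exact: measurableC.
  move=> y; rewrite /shift_preimage/A/= => h1 h2.
  have := gnD N (h *+ n + y) (- y); rewrite addrK gnN; lra.
rewrite {1}/mass (invariant_mulrn _ inv)// -/(mass _ _) massC// mass_gn_le; lra.
Qed.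

Variable U : set V.
Hypothesis mU : @measurable _ (borel V) U.

(** Averaging over [l] leaves [a] and [b] unchanged on the part of mass at
    least 2/3 that [U] carries, and differences of size [s] on the rest, of
    mass at most 1/3, cannot compensate more than [s / 2]. *)
Lemma halve_gap l (a b : V -> R) (s : R) :
  2 / 3 <= mass l U ->
  (forall x, measurable_fun [set: borel V] ((fun y : borel V => a (x + (y : V))) : borel V -> R)) ->
  (forall x, measurable_fun [set: borel V] ((fun y : borel V => b (x + (y : V))) : borel V -> R)) ->
  (forall x, 0 <= a x <= 1) -> (forall x, 0 <= b x <= 1) ->
  (forall x y, U y -> a (x + y) = a x) ->
  (forall x y, U y -> b (x + y) = b x) ->
  (forall x, b x <= a x + s) -> 0 <= s ->
  (forall x, \int[l]_y (a (x + (y : V)))%:E = \int[l]_y (b (x + (y : V)))%:E)%E ->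
  forall x, a x <= b x + s / 2.
Proof.
move=> lU ma mb a01 b01 aU bU ab s0 E x.
have mUc : @measurable _ (borel V) (~` U) by exact: measurableC.
have split_int (f : V -> R) :
    measurable_fun [set: borel V] ((fun y : borel V => f (x + (y : V))) : borel V -> R) ->
    (forall x, 0 <= f x <= 1) -> (forall x y, U y -> f (x + y) = f x) ->
    (\int[l]_y (f (x + (y : V)))%:E =
      (f x)%:E * (mass l U)%:E + \int[l]_(y in ~` U) (f (x + (y : V)))%:E)%E.
  move=> mf f01 fU.
  rewrite -(setUv U) ge0_integral_setU//=; last 3 first.
  - by rewrite setUv; apply/measurable_EFinP.
  - by move=> y _; rewrite lee_fin; case/andP: (f01 (x + y)).
  - by apply/disj_setPS; rewrite setICr.
  congr (_ + _)%E; rewrite -massE// -integral_cst//.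
  by apply: eq_integral => y; rewrite inE => Uy; rewrite fU.
have := E x; rewrite (split_int a)// (split_int b)//.
have mfE (f : V -> R) :
    measurable_fun [set: borel V] ((fun y : borel V => f (x + (y : V))) : borel V -> R) ->
    measurable_fun (~` U : set (borel V)) ((fun y : borel V => (f (x + (y : V)))%:E) : borel V -> \bar R).
  by move=> mf; apply/measurable_EFinP; apply: measurable_funTS.
have Iab : (\int[l]_(y in ~` U) (b (x + (y : V)))%:E <=
    \int[l]_(y in ~` U) (a (x + (y : V)))%:E + (s * mass l (~` U))%:E)%E.
  apply: (@le_trans _ _ (\int[l]_(y in ~` U) ((a (x + (y : V)))%:E + s%:E))%E).
    apply: ge0_le_integral => //.
    - by move=> y _; rewrite lee_fin; case/andP: (b01 (x + y)).
    - exact: mfE.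
    - by apply: (emeasurable_funD (mfE a _)) => //.
    - by move=> y _; rewrite -EFinD lee_fin.
  rewrite ge0_integralD//=.
  - by rewrite integral_cst// EFinM -massE.
  - by move=> y _; rewrite lee_fin; case/andP: (a01 (x + y)).
  - exact: mfE.
have Ib : (0 <= \int[l]_(y in ~` U) (a (x + (y : V)))%:E <= 1)%E.
  apply/andP; split.
    by apply: integral_ge0 => y _; rewrite lee_fin; case/andP: (a01 (x + y)).
  apply: (@le_trans _ _ (\int[l]_(y in ~` U) 1)%E).
    apply: ge0_le_integral => //.
    - by move=> y _; rewrite lee_fin; case/andP: (a01 (x + y)).
    - exact: mfE.
    - by move=> y _; rewrite lee_fin; case/andP: (a01 (x + y)).
  by rewrite integral_cst// mul1e probability_le1.
have Ib0 : (0 <= \int[l]_(y in ~` U) (b (x + (y : V)))%:E)%E.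
  by apply: integral_ge0 => y _; rewrite lee_fin; case/andP: (b01 (x + y)).
move: Iab Ib Ib0; rewrite massC//.
case: (\int[l]_(y in ~` U) (a (x + y))%:E)%E => [ia||]; last 2 first.
- by move=> _ /andP[_]; rewrite leye_eq.
- by move=> _ /andP[].
case: (\int[l]_(y in ~` U) (b (x + y))%:E)%E => [ib||] //.
rewrite -!EFinM -!EFinD !lee_fin => h1 /andP[h2 h3] h4 [h5].
have := mass_le1 l mU; move: lU h1 h5.
move: (mass l U) => p p23 h1 h5 p1.
have h6 : (a x - b x) * p <= s * (1 - p) by lra.
have h7 : s * (1 - p) <= s / 2 * p by nra.
have h8 : (a x - b x - s / 2) * p <= 0 by lra.
have p0 : 0 < p by lra.
by move: h8; rewrite pmulr_lle0//; lra.
Qed.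

Hypothesis UD : forall x y, U x -> U y -> U (x + y).
Hypothesis UN : forall x, U x -> U (- x).
Hypothesis U0 : U 0.

Lemma shift_preimage_subgroup (x y : V) : U y -> shift_preimage (x + y) U = shift_preimage x U.
Proof.
move=> Uy; apply/seteqP; split => z; rewrite /shift_preimage/= => h.
  by have := UD h (UN Uy); rewrite addrAC addrK.
by rewrite addrAC; exact: UD.
Qed.

Variable h : V.

Definition translates_agree l := forall x,
  mass l (shift_preimage x U) = mass l (shift_preimage (h + x) U).

(** Convolution by [l1] is injective on the bounded [U]-invariant function
    that compares the mass of a translate of [U] with the mass of its
    translate by [h]: iterate [halve_gap]. *)
Lemma agree_conv l1 l2 : 2 / 3 <= mass l1 U -> translates_agree (conv l1 l2) ->
  translates_agree l2.
Proof.
move=> l1U agr.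
have mt x := measurable_shift_preimage x mU.
pose a x := mass l2 (shift_preimage x U); pose b x := mass l2 (shift_preimage (h + x) U).
have ma (z x : V) : measurable_fun [set: borel V]
    ((fun y : borel V => mass l2 (shift_preimage (z + (x + (y : V))) U)) : borel V -> R).
  apply/measurable_EFinP.
  rewrite (_ : EFin \o _ = (fun y : borel V => l2 (shift_preimage y (shift_preimage (z + x) U)))).
    apply: measurable_prob_shift; exact: measurable_shift_preimage.
  by apply/funext => y /=; rewrite shift_preimageD addrA massE.
have a01 x : 0 <= a x <= 1 by rewrite mass_ge0 mass_le1.
have b01 x : 0 <= b x <= 1 by rewrite mass_ge0 mass_le1.
have aU x y : U y -> a (x + y) = a x by move=> Uy; rewrite /a (shift_preimage_subgroup x Uy).
have bU x y : U y -> b (x + y) = b x by move=> Uy; rewrite /b addrA (shift_preimage_subgroup (h + x) Uy).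
have E x : (\int[l1]_y (a (x + (y : V)))%:E = \int[l1]_y (b (x + (y : V)))%:E)%E.
  have cE z : (\int[l1]_y (mass l2 (shift_preimage (z + (y : V)) U))%:E)%E =
      (mass (conv l1 l2) (shift_preimage z U))%:E.
    rewrite -massE// convE//; apply: eq_integral => y _.
    by rewrite shift_preimageD -massE.
  rewrite /a cE agr -cE; apply: eq_integral => y _.
  by rewrite /b addrA.
have maa x : measurable_fun [set: borel V] ((fun y : borel V => a (x + (y : V))) : borel V -> R).
  rewrite (_ : (fun y => _) = (fun y : borel V => mass l2 (shift_preimage (0 + (x + (y : V))) U))).
    exact: ma.
  by apply/funext => y; rewrite add0r.
(* the starting gap is at most 1, as a and b are probabilities *)
have gap n x : a x <= b x + 2^-1 ^+ n /\ b x <= a x + 2^-1 ^+ n.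
  elim: n x => [|n IH] x.
    rewrite expr0; have /andP[? ?] := a01 x; have /andP[? ?] := b01 x; lra.
  have p0 : 0 <= 2^-1 ^+ n :> R by rewrite exprn_ge0// invr_ge0.
  rewrite exprSr; split.
    by apply: (halve_gap l1U maa (ma h)) => // y; have [] := IH y.
  by apply: (halve_gap l1U (ma h) maa) => // y; have [] := IH y.
move=> x; apply/eqP; rewrite -/(a x) -/(b x) eq_le.
have small e : 0 < e -> exists n, 2^-1 ^+ n <= e :> R.
  move=> e0; have [||n /(_ n (leqnn n))] := @geometric_small R 1 2^-1 e => //.
    by apply/andP; split; lra.
  by rewrite mul1r => /ltW; exists n.
by apply/andP; split; apply/ler_addgt0Pr => e /small[n ne];
  have [h1 h2] := gap n x; rewrite (le_trans h1, le_trans h2)// lerD2l.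
Qed.

(** Removing the factors one by one leaves the unit mass at 0, which
    distinguishes [U] from its translate by [h] unless [h] is in [U]. *)
Lemma agree_big (I : eqType) (s : seq I) (F : I -> law R V) :
  (forall i, i \in s -> 2 / 3 <= mass (F i) U) ->
  translates_agree (\big[conv/law1]_(i <- s) F i) -> U h.
Proof.
elim: s => [_|i s IH sU]; last first.
  rewrite big_cons => /agree_conv ag; apply: IH.
    by move=> j js; apply: sU; rewrite in_cons js orbT.
  by apply: ag; apply: sU; rewrite mem_head.
rewrite big_nil => /(_ 0); rewrite /mass !law1E; try exact: measurable_shift_preimage.
rewrite !indicE/= addr0 mem_set; last by rewrite /shift_preimage/= addr0.
have [hU _|nU /eqP] := boolP ((0 : V) \in (shift_preimage h U : set V)); last by rewrite oner_eq0.
by move: hU; rewrite inE /shift_preimage/= addr0.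
Qed.

End Invariance.

(** * Finite-dimensional spaces and their linear contractions *)

Section CoordNorm.
Context (R : realType) (K : ratCompletion R) (E : vectType K).
Local Notation V := (fin_dim_sctGroup E).
Local Notation b := (vbasis {:E}).

Definition cnorm (x : E) : R := \big[Num.max/0]_(i < \dim {:E}) rc_abs (coord b i x).

Lemma coord_distE (x y : E) : @coord_dist R K E x y = cnorm (x - y).
Proof. by apply: eq_bigr => i _; rewrite linearB. Qed.

Lemma cnorm_ge0 x : 0 <= cnorm x.
Proof. exact: bigmax_ge_id. Qed.

Lemma le_cnorm x i : rc_abs (coord b i x) <= cnorm x.
Proof. exact: (le_bigmax _ (fun i => rc_abs (coord b i x))). Qed.

Lemma cnorm_le x c : 0 <= c -> (forall i, rc_abs (coord b i x) <= c) -> cnorm x <= c.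
Proof. by move=> c0 h; apply: bigmax_le. Qed.

Lemma cnorm_lt x c : 0 < c -> (forall i, rc_abs (coord b i x) < c) -> cnorm x < c.
Proof. by move=> c0 h; apply: bigmax_lt. Qed.

Lemma cnorm0 : cnorm 0 = 0.
Proof.
apply/le_anti; rewrite cnorm_ge0 andbT; apply: cnorm_le => // i.
by rewrite linear0 rc_abs0.
Qed.

Lemma cnorm_eq0 x : cnorm x = 0 -> x = 0.
Proof.
move=> x0; rewrite (coord_vbasis (memvf x)) big1// => i _.
suff /eqP -> : coord b i x == 0 by rewrite scale0r.
by rewrite -rc_abs_eq0 eq_le rc_abs_ge0 andbT -x0 le_cnorm.
Qed.

Lemma cnormZ (a : K) x : cnorm (a *: x) = rc_abs a * cnorm x.
Proof.
have le (c : K) y : cnorm (c *: y) <= rc_abs c * cnorm y.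
  apply: cnorm_le => [|i]; first by rewrite mulr_ge0 ?cnorm_ge0// rc_abs_ge0.
  by rewrite linearZ/= rc_absM ler_wpM2l ?rc_abs_ge0// le_cnorm.
apply/le_anti; rewrite le/=.
have [->|a0] := eqVneq a 0; first by rewrite rc_abs0 mul0r cnorm_ge0.
have aa : rc_abs a * rc_abs a^-1 = 1 by rewrite -rc_absM mulfV// rc_abs1.
have := le a^-1 (a *: x); rewrite scalerA mulVf// scale1r => h.
have := ler_wpM2l (rc_abs_ge0 a) h.
by rewrite mulrA aa mul1r.
Qed.

Lemma cnormN x : cnorm (- x) = cnorm x.
Proof. by apply: eq_bigr => i _; rewrite linearN rc_absN. Qed.

Lemma cnormD x y : cnorm (x + y) <= cnorm x + cnorm y.
Proof.
apply: cnorm_le => [|i]; first by rewrite addr_ge0// cnorm_ge0.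
by rewrite linearD (le_trans (rc_absD _ _))// lerD// le_cnorm.
Qed.

Lemma cnorm_nbhs (x : V) (A : set V) :
  nbhs x A <-> exists2 e : R, 0 < e & forall y : V, cnorm ((y : E) - x) < e -> A y.
Proof.
split=> [/nbhs_ballP[e /= e0 eA]|[e e0 eA]].
  exists e => // y yx; apply: eA; rewrite /ball/= coord_distE -cnormN opprB.
  exact: yx.
apply/nbhs_ballP; exists e => // y; rewrite /ball/= coord_distE => xy.
by apply: eA; rewrite -cnormN opprB.
Qed.

Lemma cnorm_complete (u : nat -> E) :
  (forall e : R, 0 < e -> exists n, forall k, (n <= k)%N -> cnorm (u k - u n) < e) ->
  exists l, forall e : R, 0 < e -> exists n, forall k, (n <= k)%N -> cnorm (u k - l) < e.
Proof.
move=> cu; have /choice[l lP] : forall i : 'I_(\dim {:E}), exists l : K,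
    forall e : R, 0 < e -> exists n, forall k, (n <= k)%N -> rc_abs (coord b i (u k) - l) < e.
  move=> i; apply: rc_complete => e e0.
  have [|n nP] := cu (e / 2); first by rewrite divr_gt0.
  exists n => j k nj nk; rewrite (splitr e).
  have -> : coord b i (u j) - coord b i (u k) =
      coord b i (u j - u n) - coord b i (u k - u n) by rewrite !linearB/=; ring.
  apply: (le_lt_trans (rc_absD _ _)); rewrite rc_absN.
  by apply: ltrD; apply: le_lt_trans (le_cnorm _ _) _; exact: nP.
exists (\sum_i l i *: b`_i) => e e0.
have /choice[n nP] : forall i, exists n, forall k, (n <= k)%N -> rc_abs (coord b i (u k) - l i) < e.
  by move=> i; exact: lP.
exists (\max_i n i)%N => k nk; apply: cnorm_lt => // i.
rewrite linearB/= coord_sum_free; last exact: basis_free (vbasisP _).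
by apply: nP; apply: leq_trans nk; exact: leq_bigmax.
Qed.

Definition coord_norm : group_norm R V :=
  @GroupNorm R V (cnorm : V -> R) cnorm_ge0 cnorm0 cnorm_eq0 cnormN cnormD
    cnorm_nbhs cnorm_complete.

Definition linear_map (f : E -> E) :=
  {morph f : x y / x + y} /\ (forall a x, f (a *: x) = a *: f x).

Lemma linear_map_sum f I (r : seq I) (F : I -> E) : linear_map f ->
  f (\sum_(i <- r) F i) = \sum_(i <- r) f (F i).
Proof.
move=> [fD fZ]; apply: (big_morph f) => //.
exact: additive0.
Qed.

(** An upper bound of the operator norm, read off the images of a basis. *)
Definition operator_bound (f : E -> E) := \sum_(i < \dim {:E}) cnorm (f b`_i).

Lemma operator_boundP f x : linear_map f -> cnorm (f x) <= operator_bound f * cnorm x.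
Proof.
move=> lf; rewrite {1}(coord_vbasis (memvf x)) linear_map_sum//.
apply: (@le_trans _ _ (\sum_(i < \dim {:E}) cnorm (f (coord b i x *: b`_i)))).
  elim/big_rec2 : _ => [|i y z _ h]; first by rewrite cnorm0.
  by apply: (le_trans (cnormD _ _)); rewrite lerD2l.
rewrite mulr_suml; apply: ler_sum => i _.
by rewrite lf.2 cnormZ mulrC ler_wpM2l ?cnorm_ge0// le_cnorm.
Qed.

Lemma additive_ratr f (q : rat) x : {morph f : x y / x + y :> E} ->
  f ((ratr q : K) *: x) = (ratr q : K) *: f x.
Proof.
move=> fD.
have f0 : f 0 = 0 := additive0 fD.
have fN y : f (- y) = - f y.
  by apply/eqP; rewrite -addr_eq0 -fD addNr f0.
have fn n y : f (y *+ n) = f y *+ n.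
  by elim: n => [|n IH]; rewrite ?mulr0n// !mulrS fD IH.
have fz (z : int) y : f (z%:~R *: y) = (z%:~R : K) *: f y.
  rewrite !scaler_int; case: z => n; first exact: fn.
  by rewrite NegzE !mulrNz fN; congr (- _); exact: fn.
(* if the denominator vanishes in K, the scalar is 0 by convention *)
rewrite /ratr; have [->|d0] := eqVneq ((denq q)%:~R : K) 0.
  by rewrite invr0 mulr0 !scale0r.
have := fz (denq q) (((numq q)%:~R / (denq q)%:~R) *: x).
rewrite scalerA mulrCA mulfV// mulr1 fz => h.
by rewrite [in RHS]mulrC -[RHS]scalerA h scalerA mulVf// scale1r.
Qed.

(** An additive map commutes with rational scalars, and these are dense. *)
Lemma continuous_linear_map (f : V -> V) : continuous f -> {morph f : x y / x + y} -> linear_map f.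
Proof.
move=> cf fD; split=> // a x.
have f0 : f 0 = 0 := additive0 fD.
apply/eqP; rewrite -subr_eq0; apply/eqP/cnorm_eq0/le_anti.
rewrite cnorm_ge0 andbT; apply/ler_addgt0Pl => e e0; rewrite addr0.
have e20 : 0 < e / 2 by rewrite divr_gt0.
have : nbhs (f 0) [set y : V | cnorm ((y : E) - f 0) < e / 2].
  by apply/cnorm_nbhs; exists (e / 2).
move=> /cf/cnorm_nbhs[d d0 dP].
pose d1 := Num.min (d / (1 + cnorm x)) (e / 2 / (1 + cnorm (f x))).
have p1 y : 0 < 1 + cnorm y by rewrite ltr_pwDl// cnorm_ge0.
have d10 : 0 < d1 by rewrite /d1 lt_min !divr_gt0.
have [q] := rc_dense a d10; rewrite lt_min => /andP[q1 q2].
have -> : (f (a *: x : E) : E) - a *: (f x : E) =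
    (f ((a - ratr q) *: x : E) : E) - (a - ratr q) *: (f x : E).
  have -> : f (a *: x) = f ((a - ratr q) *: x + (ratr q : K) *: x :> E).
    by rewrite -scalerDl subrK.
  rewrite fD (additive_ratr _ _ fD); set A := f _.
  by rewrite scalerBl opprB addrA.
apply: (le_trans (cnormD _ _)); rewrite cnormN cnormZ (splitr e) lerD//.
  apply/ltW; have := dP ((a - ratr q) *: x); rewrite /= f0 !subr0; apply.
  rewrite cnormZ; apply: le_lt_trans (_ : _ <= rc_abs (a - ratr q) * (1 + cnorm x)) _.
    by rewrite ler_wpM2l ?rc_abs_ge0// lerDr.
  by rewrite -ltr_pdivlMr.
apply: (@le_trans _ _ (rc_abs (a - ratr q) * (1 + cnorm (f x)))).
  by rewrite ler_wpM2l ?rc_abs_ge0// lerDr.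
by rewrite -ler_pdivlMr// ltW.
Qed.

Lemma linear_map_iter f n : linear_map f -> linear_map (iter n f).
Proof.
move=> [fD fZ]; elim: n => [|n [IHD IHZ]]; first by split.
by split=> [x y|a x] /=; rewrite ?IHD ?fD// IHZ fZ.
Qed.

(** Pointwise convergence to 0 on a basis makes some iterate [m] halve the
    norm; dividing an exponent by [m] gives the geometric rate. *)
Lemma contraction_iter_le (T : contractive_automorphism V) :
  exists B r, [/\ 1 <= B, 0 < r < 1 & forall n x,
    cnorm (iter n T x) <= B * r ^+ n * cnorm x].
Proof.
have lT : linear_map T := continuous_linear_map (@contraction_continuous _ T) (@contraction_add _ T).
pose d := \dim {:E}.
have dd0 : 0 < (2 * d.+1%:R)^-1 :> R by rewrite invr_gt0 mulr_gt0.
have /choice[n nP] : forall i : 'I_d, exists n, forall k, (n <= k)%N ->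
    cnorm (iter k T b`_i) <= (2 * d.+1%:R)^-1.
  move=> i; have : nbhs (0 : V) [set y : V | cnorm ((y : E) - 0) < (2 * d.+1%:R)^-1].
    by apply/cnorm_nbhs; exists (2 * d.+1%:R)^-1.
  move=> /(@Defs.contraction_cvg _ T b`_i)[n0 _ n0P]; exists n0 => k /n0P /=.
  by rewrite subr0 => /ltW.
(* the d basis vectors together contribute at most 1 / 2 *)
pose m := (\max_i n i).+1.
have half x : cnorm (iter m T x) <= 2^-1 * cnorm x.
  apply: (le_trans (operator_boundP x (linear_map_iter m lT))); rewrite ler_wpM2r ?cnorm_ge0//.
  apply: (@le_trans _ _ (\sum_(i < d) (2 * d.+1%:R)^-1)).
    apply: ler_sum => i _; apply: nP; rewrite /m leqW//.
    exact: (leq_bigmax i).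
  rewrite sumr_const card_ord -[leLHS]mulr_natr.
  have -> : (2 * d.+1%:R)^-1 * d%:R = 2^-1 * (d%:R / d.+1%:R) :> R.
    by rewrite invfM; ring.
  by rewrite ger_pMr ?invr_gt0// ler_pdivrMr// mul1r ler_nat.
pose A := 1 + operator_bound T.
have lb0 : 0 <= operator_bound T by apply: sumr_ge0 => i _; exact: cnorm_ge0.
have A1 : 1 <= A by rewrite lerDl.
have TA x : cnorm (T x) <= A * cnorm x.
  by apply: (le_trans (operator_boundP x lT)); rewrite ler_wpM2r ?cnorm_ge0// lerDr.
have iterA k x : cnorm (iter k T x) <= A ^+ k * cnorm x.
  elim: k => [|k IH]; first by rewrite mul1r.
  apply: (le_trans (TA _)); rewrite exprS -mulrA ler_wpM2l//.
  by rewrite (le_trans _ A1).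
have h01 : 0 <= (2^-1 : R) < 1 by apply/andP; split; lra.
have [r /andP[r0 r1] hr] := @root_lt1 R 2^-1 m h01.
have A0 : 0 < A by rewrite (lt_le_trans _ A1).
exists (A ^+ m / r ^+ m), r; split; rewrite ?r0//.
  rewrite ler_pdivlMr ?exprn_gt0// mul1r (@le_trans _ _ 1)//.
    by rewrite exprn_ile1// ltW.
  by rewrite exprn_ege1.
elim/ltn_ind => k IH x.
have [km|mk] := ltnP k m.
  apply: (le_trans (iterA k x)); rewrite ler_wpM2r ?cnorm_ge0//.
  apply: (@le_trans _ _ (A ^+ m)); first by rewrite ler_weXn2l// ltnW.
  rewrite -mulrA ler_peMr ?exprn_ge0 ?(ltW A0)// mulrC ler_pdivlMr ?exprn_gt0//.
  by rewrite mul1r ler_wiXn2l// ?(ltW r0) ?(ltW r1)// ltnW.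
have -> : k = (m + (k - m))%N by rewrite subnKC.
rewrite iterD; apply: (le_trans (half _)).
have h1 : cnorm (iter (k - m) T x) <= A ^+ m / r ^+ m * r ^+ (k - m) * cnorm x.
  by apply: IH; rewrite /m; lia.
rewrite exprD.
apply: (@le_trans _ _ (r ^+ m * (A ^+ m / r ^+ m * r ^+ (k - m) * cnorm x))).
  by apply: ler_pM => //; exact: cnorm_ge0.
move: (A ^+ m) (r ^+ m) (r ^+ (k - m)) (cnorm x) => a1 a2 a3 a4.
by rewrite le_eqVlt; apply/orP; left; apply/eqP; ring.
Qed.

(** The inverse is continuous and additive, hence bounded. *)
Lemma contraction_ge (T : contractive_automorphism V) :
  exists2 c, 0 < c & forall x, cnorm x <= c * cnorm (T x).
Proof.
have [S [TS ST cS]] := @contraction_inverse _ T.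
have SD : {morph S : x y / x + y}.
  by move=> x y; rewrite -{1}[x]ST -{1}[y]ST -contraction_add TS.
have lS : linear_map S := continuous_linear_map cS SD.
have lb0 : 0 <= operator_bound S by apply: sumr_ge0 => i _; exact: cnorm_ge0.
exists (1 + operator_bound S); first by rewrite ltr_pwDl.
move=> x; rewrite -{1}[x]TS; apply: (le_trans (operator_boundP _ lS)).
by rewrite ler_wpM2r ?cnorm_ge0// lerDr.
Qed.

Section Commuting.
Variables (m : nat) (T : 'I_m -> contractive_automorphism V).
Hypothesis TC : forall i j x, T i (T j x) = T j (T i x).

(** Sorting the letters turns the composite along a word into a product of
    powers of the [m] maps, so the constants of [contraction_iter_le] are
    multiplied only [m] times. *)
Lemma act_bound : exists B r, [/\ 0 < B, 0 < r < 1 & forall w x,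
  cnorm (act (fun i => T i : V -> V) w x) <= B * r ^+ size w * cnorm x].
Proof.
have /choice[Br BrP] : forall i, exists Br : R * R, [/\ 1 <= Br.1, 0 < Br.2 < 1 &
    forall n x, cnorm (iter n (T i) x) <= Br.1 * Br.2 ^+ n * cnorm x].
  by move=> i; have [B [r ?]] := contraction_iter_le (T i); exists (B, r).
pose r := \big[Num.max/2^-1]_i (Br i).2.
pose B := \big[Num.max/1]_i (Br i).1.
have r0 : 0 < r.
  by apply: (@lt_le_trans _ _ 2^-1); [rewrite invr_gt0|exact: bigmax_ge_id].
have r1 : r < 1.
  apply: bigmax_lt => [|i _]; first lra.
  by have [_ /andP[_ ?] _] := BrP i.
have B1 : 1 <= B by exact: bigmax_ge_id.
have B0 : 0 < B by rewrite (lt_le_trans _ B1).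
have iterP i n x : cnorm (iter n (T i) x) <= B * r ^+ n * cnorm x.
  have [b1 /andP[c0 c1] h] := BrP i; apply: (le_trans (h n x)).
  rewrite ler_wpM2r ?cnorm_ge0// ler_pM ?exprn_ge0 ?(ltW c0)//.
  - by rewrite (le_trans _ b1).
  - exact: (le_bigmax _ (fun i => (Br i).1)).
  - rewrite lerXn2r ?nnegrE ?(ltW c0) ?(ltW r0)//.
    exact: (le_bigmax _ (fun i => (Br i).2)).
exists (B ^+ m), r; split; rewrite ?exprn_gt0 ?r0// => w x.
have act_nseq i n y : act (fun i => T i : V -> V) (nseq n i) y = iter n (T i) y.
  by elim: n => //= n ->.
have act_flatten (l : seq 'I_m) (c : 'I_m -> nat) y :
    cnorm (act (fun i => T i : V -> V) (flatten [seq nseq (c i) i | i <- l]) y) <=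
    B ^+ size l * r ^+ size (flatten [seq nseq (c i) i | i <- l]) * cnorm y.
  elim: l => [|i l IH]; first by rewrite !mul1r.
  rewrite /= act_cat act_nseq; apply: (le_trans (iterP _ _ _)).
  rewrite size_cat size_nseq exprS exprD.
  apply: (@le_trans _ _ (B * r ^+ c i * (B ^+ size l *
    r ^+ size (flatten [seq nseq (c i) i | i <- l]) * cnorm y))).
    by rewrite ler_wpM2l// mulr_ge0 ?exprn_ge0 ?ltW.
  move: (r ^+ c i) (B ^+ size l) (r ^+ size _) (cnorm y) => a1 a2 a3 a4.
  by rewrite le_eqVlt; apply/orP; left; apply/eqP; ring.
have pw := perm_count_undup w.
rewrite -(act_perm TC x pw) -(perm_size pw).
apply: (le_trans (act_flatten _ _ _)).
rewrite ler_wpM2r ?cnorm_ge0// ler_wpM2r ?exprn_ge0 ?(ltW r0)// ler_weXn2l//.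
rewrite -[X in (_ <= X)%N](card_ord m) -(card_uniqP (undup_uniq w)).
exact: max_card.
Qed.

Lemma family_ge : exists2 c, 0 < c & forall i x, cnorm x <= c * cnorm (T i x).
Proof.
have /choice[c cP] : forall i, exists c, 0 < c /\ forall x, cnorm x <= c * cnorm (T i x).
  by move=> i; have [c c0 h] := contraction_ge (T i); exists c.
exists (\big[Num.max/1]_i c i).
  by apply: (@lt_le_trans _ _ 1) => //; exact: bigmax_ge_id.
move=> i x; have [c0 h] := cP i; apply: (le_trans (h x)).
by rewrite ler_wpM2r ?cnorm_ge0//; exact: (le_bigmax _ c).
Qed.

End Commuting.

Lemma cnorm_ultrametric : (forall a c : K, rc_abs (a + c) <= Num.max (rc_abs a) (rc_abs c)) ->
  forall x y, cnorm (x + y) <= Num.max (cnorm x) (cnorm y).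
Proof.
move=> um x y; apply: cnorm_le => [|i]; first by rewrite le_max cnorm_ge0.
rewrite linearD (le_trans (um _ _))// ge_max !le_max !le_cnorm//=.
by rewrite orbT.
Qed.

End CoordNorm.

Lemma padic_nat_le1 (R : realType) p (K : ratCompletion R) : prime p -> is_padic p K ->
  forall n, rc_abs (n%:R : K) <= 1.
Proof.
move=> pp Kp n; have := Kp n%:R; rewrite ratr_nat => ->; rewrite /padic_abs.
case: eqP => // _; rewrite -[n%:R]/(n%:Z%:Q) numq_int denq_int/= logn1 sub0r.
rewrite -exprnN invf_le1 ?exprn_gt0 ?ltr0n ?prime_gt0//.
by rewrite exprn_ege1// ler1n prime_gt0.
Qed.

(** The binomial theorem gives [rc_abs (a + c) ^ n <= (n + 1) * M ^ n] with
    [M] the maximum; the linear factor is negligible as [n] grows. *)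
Lemma ultrametric_of_nat_le1 (R : realType) (K : ratCompletion R) :
  (forall n, rc_abs (n%:R : K) <= 1) ->
  forall a c : K, rc_abs (a + c) <= Num.max (rc_abs a) (rc_abs c).
Proof.
move=> n1 a c; set M := Num.max _ _; rewrite leNgt; apply/negP => Mac.
have M0 : 0 <= M by rewrite le_max rc_abs_ge0.
have absX (x : K) n : rc_abs (x ^+ n) = rc_abs x ^+ n.
  by elim: n => [|n IH]; rewrite ?expr0 ?rc_abs1// !exprS rc_absM IH.
have pow n : rc_abs (a + c) ^+ n <= n.+1%:R * M ^+ n.
  rewrite -absX exprDn.
  apply: (@le_trans _ _ (\sum_(i < n.+1) M ^+ n)); last first.
    by rewrite sumr_const card_ord mulr_natl.
  apply: (@le_trans _ _ (\sum_(i < n.+1) rc_abs (a ^+ (n - i) * c ^+ i *+ 'C(n, i)))).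
    elim/big_rec2 : _ => [|i y z _ h]; first by rewrite rc_abs0.
    by apply: (le_trans (rc_absD _ _)); rewrite lerD2l.
  apply: ler_sum => i _; rewrite -mulr_natr !rc_absM.
  rewrite -[leRHS]mulr1 ler_pM ?mulr_ge0 ?rc_abs_ge0// !absX.
  have -> : M ^+ n = M ^+ (n - i) * M ^+ i by rewrite -exprD subnK// -ltnS.
  rewrite ler_pM ?exprn_ge0 ?rc_abs_ge0// lerXn2r ?nnegrE ?rc_abs_ge0//.
    by rewrite /M le_max lexx.
  by rewrite /M le_max lexx orbT.
have z0 : 0 < rc_abs (a + c) by rewrite (le_lt_trans M0).
have [M00|Mn0] := eqVneq M 0.
  by have := pow 1; rewrite M00 expr1 expr1 mulr0 leNgt z0.
have Mpos : 0 < M by rewrite lt_def Mn0.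
have h01 : 0 < M / rc_abs (a + c) < 1 by rewrite divr_gt0//= ltr_pdivrMr// mul1r.
have [C [g [C0 g01 _ Cg]]] := poly_geometric 1 h01.
have [||n /(_ n (leqnn n))] := @geometric_small R C g 1 => //.
rewrite ltNge => /negP; apply; apply: le_trans (Cg n).
by rewrite expr1 exprMn exprVn mulrA ler_pdivlMr ?exprn_gt0// mul1r.
Qed.

(** * Infinite divisibility and absence of idempotent factors *)

Section Main.
Context (R : realType) (K : ratCompletion R) (E : vectType K).
Local Notation V := (fin_dim_sctGroup E).
Local Notation N := (coord_norm E).
Local Notation conv := (@conv R V).
Local Notation law1 := (law1 R V).
Variables (m : nat) (T : 'I_m -> contractive_automorphism V).
Hypothesis m0 : (0 < m)%N.
Hypothesis TC : forall i j x, T i (T j x) = T j (T i x).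
Variable mu : law R V.
Hypothesis muE : mu = \big[conv/law1]_(i < m) image_law (T i) mu.

Let mT i : measurable_fun [set: borel V] (T i : borel V -> borel V) :=
  continuous_borel_measurable (@contraction_continuous _ (T i)).
Let TD i : {morph (T i : V -> V) : x y / x + y} := @contraction_add _ (T i).

Lemma exists_root k : (0 < k)%N -> exists nu, mu = conv_power nu k.
Proof.
move=> k0; have [B [r [B0 r01 actB]]] := act_bound TC.
have [c c0 Tc] := family_ge T.
exact: (@law_root _ _ N _ _ mT TD TC _ muE B r c B0 r01 actB c0 Tc m0 k k0).
Qed.

(** The ball [U] of radius [N h] is a subgroup that does not contain [h],
    while long words contract most of the mass of [mu] into [U]. *)
Lemma not_invariant_of_ultrametric (h : V) :
  (forall a c : K, rc_abs (a + c) <= Num.max (rc_abs a) (rc_abs c)) ->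
  h != 0 -> ~ invariant_by h mu.
Proof.
move=> um h0 inv; have [B [r [B0 r01 actB]]] := act_bound TC.
pose U : set V := [set x | N x < N h].
have mU : @measurable _ (borel V) U by exact: measurable_gn_lt.
have hpos : 0 < N h.
  by rewrite lt_def gn_ge0 andbT; apply: contra_neq h0 => /gn_eq0.
have UD x y : U x -> U y -> U (x + y).
  rewrite /U/= => xh yh; apply: le_lt_trans (cnorm_ultrametric um _ _) _.
  by rewrite gt_max; apply/andP; split.
have UN x : U x -> U (- x) by rewrite /U/= cnormN.
have U0 : U 0 by rewrite /U/= cnorm0.
have d0 : 0 < 3^-1 :> R by rewrite invr_gt0.
have [t t0 tP] := tail_small N mu d0.
have [||n /(_ n (leqnn n)) nP] := @geometric_small R (B * t) r (N h) => //.
pose W := iter n (@expand m) [:: [::]].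
have WE : mu = words_law (fun i => T i : V -> V) mu W.
  rewrite /W; elim: (n) => [|k IH] /=.
    by rewrite /words_law big_seq1 (word_law_nil mT).
  by rewrite -(words_law_expand mT TD TC muE).
have Wn : {in W, forall w, sorted_word n w}.
  rewrite /W; elim: (n) => [|k IH] /=; last exact: expand_sorted.
  by move=> w; rewrite mem_seq1 => /eqP ->.
suff : U h by rewrite /U/= ltxx.
apply: (agree_big mU UD UN U0 (s := W) (F := word_law (fun i => T i : V -> V) mu)).
  move=> w /Wn/andP[/eqP wn _].
  have := @tail_word_law _ _ _ _ mT mu N _ _ B0 r01 actB w _ (ltW t0); rewrite wn => h1.
  apply: le_trans (_ : _ <= mass (word_law (fun i => T i : V -> V) mu w) [set x | N x <= B * r ^+ n * t]) _.
    by rewrite mass_gn_le; lra.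
  apply: mass_le => //; first exact: measurable_gn_le.
  by move=> x /= /le_lt_trans; apply; rewrite mulrAC.
rewrite -/(words_law _ mu W) -WE => x; rewrite addrC -shift_preimageD; congr fine.
by rewrite inv//; exact: measurable_shift_preimage.
Qed.

End Main.

Lemma real_scale_unbounded (R : realType) (K : ratCompletion R) (E : vectType K) (h : E) :
  (forall n, rc_abs (n%:R : K) = n%:R) -> h != 0 ->
  forall x : R, exists n, x < cnorm (h *+ n).
Proof.
move=> absn h0 x.
have hpos : 0 < cnorm h.
  by rewrite lt_def cnorm_ge0 andbT; apply: contra_neq h0 => /cnorm_eq0.
exists (Num.truncn (x / cnorm h)).+1.
by rewrite -scaler_nat cnormZ absn -ltr_pdivrMr// truncnS_gt.
Qed.

Lemma convolution_power_to_law (R : realType) (V : sctGroup) (nu : law R V) n :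
  to_law (convolution_power (of_law nu) n) = conv_power nu n.
Proof. by rewrite /convolution_power to_law_big/= of_lawK. Qed.

(** Translating the Haar factor by a nonzero element of its subgroup does not
    change the convolution. *)
Lemma idempotent_factor_invariant (R : realType) (V : sctGroup)
    (mu : probability (borel V) R) : has_idempotent_factor mu ->
  exists2 h : V, h != 0 & invariant_by h (to_law mu).
Proof.
move=> [H [omega [nu [[H0 HB] _ H1 [_ inv] muE]]]].
have [h [Hh h0]] : exists h, H h /\ h <> 0.
  apply: contrapT => /forallNP nH; apply: H1; apply/seteqP; split => h /=.
    by move=> Hh; apply: contrapT => h0; exact: (nH h).
  by move=> ->.
exists h; first exact/eqP.
have -> : to_law mu = conv (to_law omega) (to_law nu).
  by rewrite -to_law_conv; apply/eq_to_law.
apply: invariant_conv => B mB.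
by rewrite !to_lawE//; [exact: inv|exact: measurable_shift_preimage].
Qed.

Theorem theorem4p1 (R : realType) (p : nat) (p_prime : prime p)
    (K : ratCompletion R) (K_real_or_padic : K = real_completion R \/ is_padic p K)
    (E : vectType K) :
  let V := fin_dim_sctGroup E in
  (forall (m : nat) (T : 'I_m -> contractive_automorphism V) (mu : probability (borel V) R),
     (1 <= m)%N ->
     (forall (i j : 'I_m) (x : V), T i (T j x) = T j (T i x)) ->
     eq_prob mu
       (\big[@convolution R V/@dirac_at_0 R V]_(i < m) image_prob (T i) mu) ->
     infinitely_divisible mu /\ ~ has_idempotent_factor mu) /\
  (forall mu : probability (borel V) R,
     autophage mu -> infinitely_divisible mu /\ ~ has_idempotent_factor mu).
Proof.
move=> V.
have main (m : nat) (T : 'I_m -> contractive_automorphism V) (mu : probability (borel V) R) :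
    (1 <= m)%N ->
    (forall (i j : 'I_m) (x : V), T i (T j x) = T j (T i x)) ->
    eq_prob mu
      (\big[@convolution R V/@dirac_at_0 R V]_(i < m) image_prob (T i) mu) ->
    infinitely_divisible mu /\ ~ has_idempotent_factor mu.
  move=> m0 TC /eq_to_law muE.
  have {}muE : to_law mu = \big[@conv R V/law1 R V]_(i < m) image_law (T i) (to_law mu).
    by rewrite {1}muE to_law_big; apply: eq_bigr => i _; exact: image_law_to_law.
  split=> [k k0|/idempotent_factor_invariant[h h0]].
    have [nu nuE] := exists_root m0 TC muE k0.
    by exists (of_law nu); apply/eq_to_law; rewrite nuE convolution_power_to_law.
  case: K_real_or_padic => [KR|Kp]; last first.
    apply: (not_invariant_of_ultrametric TC muE) => //.
    exact: (ultrametric_of_nat_le1 (padic_nat_le1 p_prime Kp)).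
  apply: (@not_invariant_unbounded _ _ (coord_norm E)).
  apply: real_scale_unbounded => // n.
  by rewrite KR; exact: normr_nat.
split=> [|mu [T [S [TS muE]]]]; first exact: main.
pose F (i : 'I_2) := if i == ord0 then T else S.
apply: (main 2 F) => //.
- move=> i j x; rewrite /F; case: ifP => _; case: ifP => _ //; exact: TS.
- apply/eq_to_law; rewrite to_law_big !big_ord_recl big_ord0 /F/=.
  rewrite Monoid.mulm1 -to_law_conv; exact/eq_to_law.
Qed.
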